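(* Let $G$ and $H$ be finitely presented, residually finite groups with respective filtrations $(N_i)$ and $(M_i)$. If $\Box_{(N_i)}G$ is coarsely equivalent to $\Box_{(M_i)}H$, then $\beta_1^{(2)}(G)>0$ if and only if $\beta_1^{(2)}(H)>0$.
   Context: Filtration: for a residually finite, finitely generated group $G$, a filtration of $G$ is a sequence $(N_i)_{i\in\mathbb{N}}$ of nested ($N_{i+1}\subseteq N_i$), normal, finite index subgroups of $G$ with $\bigcap_i N_i=\{e\}$. Box space: fix a finite generating set $S$ of $G$. The box space $\Box_{(N_i)}G$ is the disjoint union $\bigsqcup_i G/N_i$, where each component $G/N_i$ carries the Cayley graph metric with respect to the image of $S$, and the distance between any two distinct components (i.e. between points of them) is the sum of their diameters. Changing the finite generating set gives a coarsely equivalent space. Coarse equivalence: a map $\varphi:X\to Y$ between metric spaces is a coarse embedding if there are proper functions $\rho_\pm:\mathbb{R}_+\to\mathbb{R}_+$ with $\rho_-(d_X(a,b))\le d_Y(\varphi(a),\varphi(b))\le\rho_+(d_X(a,b))$ for all $a,b\in X$. It is a coarse equivalence if moreover there is $C>0$ such that every $y\in Y$ is at distance at most $C$ from $\varphi(X)$. $X$ and $Y$ are coarsely equivalent if a coarse equivalence $X\to Y$ exists. $\beta_1^{(2)}(G)$ denotes the first $\ell^2$ Betti number of $G$. For a finitely presented residually finite group $G$ and any filtration $(N_i)$ of $G$, the Lück Approximation Theorem gives $\beta_1^{(2)}(G)=\lim_{i\to\infty}\frac{b_1(N_i)}{[G:N_i]}$, where $b_1(N)$ is the classical first Betti number of $N$.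 *)

(* Defs.v *)
From HB Require Import structures.
From mathcomp Require Import all_boot all_order all_algebra.
From mathcomp Require Import all_classical all_reals all_analysis.

Set Implicit Arguments.
Unset Strict Implicit.
Unset Printing Implicit Defensive.

Import Order.TTheory GRing.Theory Num.Theory.
Import numFieldNormedType.Exports.

Local Open Scope classical_set_scope.
Local Open Scope ring_scope.

(* A letter [(a, false)] stands for the generator [a], [(a, true)] for its
   inverse. *)
Definition word (A : Type) := seq (A * bool).

Section words.
Variables (G : groupType) (n : nat) (s : 'I_n -> G).

Definition letter_eval (l : 'I_n * bool) : G :=
  (if l.2 then (s l.1)^-1 else s l.1)%g.

Definition word_eval (w : word 'I_n) : G := (\prod_(l <- w) letter_eval l)%g.

Definition generates := forall g : G, exists w, word_eval w = g.

End words.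

(* Equality in the group < 'I_n | r_0, ..., r_(m-1) >. *)
Inductive pres_eq (n m : nat) (r : 'I_m -> word 'I_n) :
    word 'I_n -> word 'I_n -> Prop :=
| pres_refl w : pres_eq r w w
| pres_sym v w : pres_eq r v w -> pres_eq r w v
| pres_trans u v w : pres_eq r u v -> pres_eq r v w -> pres_eq r u w
| pres_cancel u v i b : pres_eq r (u ++ v) (u ++ [:: (i, b); (i, ~~ b)] ++ v)
| pres_relator u v j : pres_eq r (u ++ v) (u ++ r j ++ v).

Record finite_presentation (G : groupType) := FinitePresentation {
  ngens : nat;
  nrels : nat;
  gen : 'I_ngens -> G;
  rel_word : 'I_nrels -> word 'I_ngens;
  gen_generates : generates gen;
  rel_complete :
    forall w, word_eval gen w = 1%g <-> pres_eq rel_word w [::] }.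

Definition finitely_presented (G : groupType) :=
  inhabited (finite_presentation G).

Section subgroups.
Variable G : groupType.
Implicit Types N : set G.

Definition normal_subgroup N :=
  group_closed [in N] /\ forall x g, N x -> N (x ^ g)%g.

Definition lcosets N : set (set G) :=
  range (fun g : G => [set (g * x)%g | x in N]).

Definition finite_index N := finite_set (lcosets N).

Definition residually_finite :=
  forall g : G, g <> 1%g ->
    exists N, [/\ normal_subgroup N, finite_index N & ~ N g].

Definition filtration (N : nat -> set G) :=
  [/\ forall i, normal_subgroup (N i),
      forall i, finite_index (N i),
      forall i, N i.+1 `<=` N i
    & \bigcap_i N i = [set 1%g]].

End subgroups.

(* Metric spaces are given by a carrier and a distance function. [metricType]
   cannot be used for box spaces: nothing prevents two components of a box
   space from being single points, and these are then at distance 0. *)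
Section coarse_geometry.
Variable R : realType.

(* [rho] is only meant on the nonnegative half-line. *)
Definition proper_nonneg (rho : R -> R) :=
  (forall t, 0 <= t -> 0 <= rho t) /\
  forall B : set R, bounded_set B -> bounded_set [set t | 0 <= t /\ B (rho t)].

Variables X Y : Type.
Variables (dX : X -> X -> R) (dY : Y -> Y -> R).

Definition coarse_embedding (phi : X -> Y) :=
  exists rho_m rho_p : R -> R,
    [/\ proper_nonneg rho_m, proper_nonneg rho_p
      & forall a b, rho_m (dX a b) <= dY (phi a) (phi b) <= rho_p (dX a b)].

Definition coarse_equivalence (phi : X -> Y) :=
  coarse_embedding phi /\
  exists2 C : R, 0 < C & forall y, exists x, dY y (phi x) <= C.

Definition coarsely_equivalent := exists phi, coarse_equivalence phi.

End coarse_geometry.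

Section box_space.
Variables (R : realType) (G : groupType) (n : nat) (s : 'I_n -> G).
Variable N : nat -> set G.

(* A walk from [C] to [D] in the Cayley graph of [G / N i] is a word [w] in
   the generators and their inverses with [C * w = D]. *)
Definition cayley_dist (C D : set G) : R :=
  inf [set (size w)%:R | w in
    [set w : word 'I_n | exists2 g, C g & D (g * word_eval s w)%g]].

Definition component_diam (i : nat) : R :=
  sup [set cayley_dist CD.1 CD.2 | CD in lcosets (N i) `*` lcosets (N i)].

Definition box_space := {i : nat & lcosets (N i)}.

Definition box_dist (x y : box_space) : R :=
  if tag x == tag y
  then cayley_dist (\val (tagged x)) (\val (tagged y))
  else component_diam (tag x) + component_diam (tag y).

End box_space.

Section l2.
Variables (R : realType) (I : choiceType).
Implicit Types (f g : I -> R) (V : set (I -> R)).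

Definition l2 : set (I -> R) :=
  [set f | (\esum_(x in [set: I]) (f x ^+ 2)%:E < +oo)%E].

(* The unconditional sum of a summable family; [esum] itself is only meant for
   nonnegative families. *)
Definition usum f : R :=
  fine (\esum_(x in [set: I]) (Num.max (f x) 0)%:E)
  - fine (\esum_(x in [set: I]) (Num.max (- f x) 0)%:E).

Definition l2_inner f g : R := usum (f \* g).

Definition l2_delta (x : I) : I -> R := fun y => (y == x)%:R.

(* Orthogonal projection onto [V], for a closed subspace [V] of l2. *)
Definition l2_proj V f : I -> R :=
  xget (fun=> 0) [set p | V p /\ forall v, V v -> l2_inner (f \- p) v = 0].

End l2.

(* The von Neumann dimension of a closed subspace [V] of l2(G)^n that is
   invariant under left translation by [G]. *)
Definition vn_dim (R : realType) (G : groupType) (n : nat)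
    (V : set (G * 'I_n -> R)) : R :=
  \sum_(i < n)
    l2_inner (l2_proj V (l2_delta R (1%g, i))) (l2_delta R (1%g, i)).

Section l2_betti.
Variables (R : realType) (G : groupType).

Section chain_complex.
Variable P : finite_presentation G.

Notation s := (@gen G P).
Notation r := (@rel_word G P).

(* The l2 chain complex l2(G)^nrels -> l2(G)^ngens -> l2(G) of the universal
   cover of the presentation complex of [P].  The 1-skeleton is the Cayley
   graph: [(x, i)] is the edge from [x] to [x * s i].  The 2-cell [(x, j)] is
   attached along the loop at [x] that reads the word [r j], so it crosses
   positively the edge [(x * p, i)] at each factorization [r j = p s_i q],
   and negatively the edge [(x * p s_i^-1, i)] at each factorization
   [r j = p s_i^-1 q] (Fox calculus). *)
Definition l2_d1 (f : G * 'I_(ngens P) -> R) : G -> R :=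
  fun y => \sum_(i < ngens P) (f ((y * (s i)^-1)%g, i) - f (y, i)).

Definition l2_d2 (c : G * 'I_(nrels P) -> R) : G * 'I_(ngens P) -> R :=
  fun e => \sum_(j < nrels P)
    (\sum_(k < size (r j) | tnth (in_tuple (r j)) k == (e.2, false))
       c ((e.1 * (word_eval s (take k (r j)))^-1)%g, j)
     - \sum_(k < size (r j) | tnth (in_tuple (r j)) k == (e.2, true))
       c ((e.1 * (word_eval s (take k.+1 (r j)))^-1)%g, j)).

(* First reduced l2-homology, the Hilbert G-module ker d1 / closure (im d2),
   realized in l2(G)^ngens as the orthogonal complement of im d2 in ker d1.
   Real coefficients give the same dimension as complex ones, the boundary
   operators being defined over the integers. *)
Definition reduced_l2_H1 : set (G * 'I_(ngens P) -> R) :=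
  [set f | [/\ l2 f, l2_d1 f = (fun=> 0)
             & forall c, l2 c -> l2_inner f (l2_d2 c) = 0]].

Definition l2_betti1_pres : R := vn_dim reduced_l2_H1.

End chain_complex.

(* By homotopy invariance [l2_betti1_pres P] depends only on [G], so [xget]
   picks from a singleton when [G] is finitely presented. *)
Definition l2_betti1 : R := xget 0 (range l2_betti1_pres).

End l2_betti.

(* Main.v *)
Require Import Defs.
From HB Require Import structures.
From mathcomp Require Import all_boot all_order all_algebra.
From mathcomp Require Import all_classical all_reals all_analysis.
From mathcomp Require Import finmap ring lra.

(* No approximation theorem is needed: both sides are compared through
   quasi-isometry invariance.

   A coarse equivalence f of the box spaces restricts to maps on balls around the
   base points of the components G / N_i.  As i grows these balls become isometric
   to balls of G, and their images to balls of H, so a limit along an ultrafilter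
   gives maps G -> H and H -> G that are coarse inverses of each other.

   The reduced l2-homology in degree 1 consists of the finite-energy harmonic
   cocycles, which by completeness of the relators are the gradients of harmonic
   functions on the Cayley graph.  Hence beta > 0 iff some finite-energy function
   on G stays at positive energy distance from l2(G).  This property is pulled back
   by coarse inverses: u o phi o psi differs from u by an l2 function when u has
   finite energy. *)

Set Implicit Arguments.
Unset Strict Implicit.
Unset Printing Implicit Defensive.

Import Order.TTheory GRing.Theory Num.Theory.
Import numFieldNormedType.Exports.

Local Open Scope classical_set_scope.
Local Open Scope ring_scope.

(** * Unconditional sums *)

(** Coarse maps are not homomorphisms and do not act on chains; functions, however, can be pulled
    back along any map, which is why positivity is restated as a property of functions. Only the
    vanishing of the homology module is compared, never its dimension: the dimension is a sum of
    squared norms of projections, positive exactly when the module is nonzero. The box spaces come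
    with generating families [S] and [T], the homology with the generators of a presentation.
    Closeness in a group is therefore expressed by finite subsets, not by word lengths. Two things
    could spoil the limit. A point near a base point might lie in another component; for infinite
    groups this stops once the diameters are large. And the components hit in the target might have
    bounded index, so that the limit would see a finite quotient of [H] in place of [H]; a coarse
    inverse excludes this. Finite groups, whose box spaces are bounded, are treated apart. *)

Lemma discriminant_le (R : realFieldType) (a b c : R) : 0 <= c ->
  (forall t, 0 <= a + 2 * t * b + t ^+ 2 * c) -> b ^+ 2 <= a * c.
Proof.
move=> c0 H; have [c_gt0|] := ltP 0 c.
  have := H (- b / c).
  have -> : a + 2 * (- b / c) * b + (- b / c) ^+ 2 * c = (a * c - b ^+ 2) / c.
    by field; rewrite gt_eqF.
  by rewrite pmulr_lge0 ?invr_gt0// subr_ge0.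
move=> c_le0; have {c0 c_le0}c0 : c = 0 by apply/eqP; rewrite eq_le c_le0.
rewrite c0 in H *; have [->|b0] := eqVneq b 0; first by rewrite expr0n mulr0.
(* With [c = 0] the expression is affine in [t], and this [t] gives it the value [-1]. *)
have := H (- (a + 1) / (2 * b)).
have -> : a + 2 * (- (a + 1) / (2 * b)) * b + (- (a + 1) / (2 * b)) ^+ 2 * 0 = -1.
  by field.
by rewrite oppr_ge0 ler10.
Qed.

Lemma sqrD_le (R : realFieldType) (a b : R) :
  (a + b) ^+ 2 <= 2 * a ^+ 2 + 2 * b ^+ 2.
Proof. by have := sqr_ge0 (a - b); rewrite sqrrB sqrrD; lra. Qed.

Section asum.
Variable R : realType.

Definition asum (I : choiceType) (a : I -> R) : \bar R :=
  (\esum_(x in [set: I]) (a x)%:E)%E.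

Section basic.
Variable I : choiceType.
Implicit Types a b : I -> R.

Lemma asum_ge0 a : (forall x, 0 <= a x) -> (0 <= asum a)%E.
Proof. by move=> a0; apply: esum_ge0 => x _; rewrite lee_fin. Qed.

Lemma le_asum a b : (forall x, a x <= b x) -> (asum a <= asum b)%E.
Proof. by move=> ab; apply: le_esum => x _; rewrite lee_fin. Qed.

Lemma asumD a b : (forall x, 0 <= a x) -> (forall x, 0 <= b x) ->
  asum (fun x => a x + b x) = (asum a + asum b)%E.
Proof.
by move=> a0 b0; rewrite /asum -esumD// => x _; rewrite lee_fin.
Qed.

Lemma asum_ge a x : (forall y, 0 <= a y) -> ((a x)%:E <= asum a)%E.
Proof.
move=> a0; apply: esum_ge; exists [set x]; last by rewrite fsbig_set1.
by split => //; exact: finite_set1.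
Qed.

Lemma asum_le_fset a (M : R) :
  (forall s : seq I, uniq s -> \sum_(x <- s) a x <= M) -> (asum a <= M%:E)%E.
Proof.
move=> aM; apply: ge_ereal_sup => /= _ [X [finX _] <-].
by rewrite fsbig_finite//= sumEFin lee_fin; exact/aM/fset_uniq.
Qed.

Lemma fset_le_asum a (s : seq I) : (forall x, 0 <= a x) -> uniq s ->
  ((\sum_(x <- s) a x)%:E <= asum a)%E.
Proof.
move=> a0 us; apply: esum_ge; exists [set` s].
  by split => //; exact: finite_seq.
by rewrite -fsbig_seq// sumEFin.
Qed.

Lemma asumZ (c : R) a : 0 <= c -> (forall x, 0 <= a x) ->
  asum (fun x => c * a x) = (c%:E * asum a)%E.
Proof.
(* One inequality is enough: for [c != 0] the other one is the same inequality with factor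
   [c^-1]. *)
have le (k : R) (f : I -> R) : 0 <= k -> (forall x, 0 <= f x) ->
    (asum (fun x => (k * f x)%R) <= k%:E * asum f)%E.
  move=> k0 f0; apply: ge_ereal_sup => /= _ [X [finX _] <-].
  rewrite fsbig_finite//= sumEFin -mulr_sumr EFinM lee_pmul//.
    by rewrite lee_fin sumr_ge0.
  exact/fset_le_asum/fset_uniq.
move=> c0 a0; apply/eqP; rewrite eq_le le//=.
have [->|cn0] := eqVneq c 0.
  by rewrite mul0e; apply: asum_ge0 => x; rewrite mul0r.
have cp : 0 < c by rewrite lt_neqAle eq_sym cn0.
rewrite -lee_pdivlMl//; apply: le_trans (le _ _ _ _); first last.
- by move=> x; rewrite mulr_ge0.
- by rewrite invr_ge0.
by apply: le_asum => x; rewrite mulKf.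
Qed.

Lemma reindex_asum (J : choiceType) (h : J -> I) a : bijective h ->
  asum (a \o h) = asum a.
Proof.
by rewrite -setTT_bijective => bh; rewrite /asum (reindex_esum _ _ _ _ bh).
Qed.

Lemma asum_inj_le (J : choiceType) (h : J -> I) (A : set J) a :
  (forall x, 0 <= a x) -> set_inj A h ->
  (asum (fun j => if j \in A then a (h j) else 0%R) <= asum a)%E.
Proof.
move=> a0 hA.
have -> : asum (fun j => if j \in A then a (h j) else 0) =
    (\esum_(i in h @` A) (a i)%:E)%E.
  by rewrite esum_image// [RHS]esum_mkcond; apply: eq_esum => j _; case: ifP.
rewrite esum_mkcond; apply: le_esum => i _; case: ifP => // _.
by rewrite lee_fin.
Qed.

Lemma asum_sum (J : choiceType) (s : seq J) (a : J -> I -> R) :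
  (forall j x, 0 <= a j x) ->
  asum (fun x => \sum_(j <- s) a j x) = (\sum_(j <- s) asum (a j))%E.
Proof.
move=> a0; rewrite /asum -esum_sum; last by move=> *; rewrite lee_fin.
by apply: eq_esum => x _; rewrite sumEFin.
Qed.

End basic.

Lemma asum_prod (I : choiceType) (J : finType) (a : I * J -> R) :
  (forall x, 0 <= a x) ->
  asum a = (\sum_(j : J) asum (fun x => a (x, j)))%E.
Proof.
move=> a0; rewrite -(@asum_sum I J (index_enum J) (fun j x => a (x, j)))//.
rewrite /asum (_ : [set: I * J] = [set: I] `*`` (fun=> [set: J])); last first.
  by apply/seteqP; split.
transitivity (\esum_(k in [set: I] `*`` (fun=> [set: J])) (a (k.1, k.2))%:E)%E.
  by apply: eq_esum => -[].
rewrite -(esum_esum (a := fun x y => (a (x, y))%:E)); last first.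
  by move=> *; rewrite lee_fin.
apply: eq_esum => x _; rewrite esum_fset; last first.
- by move=> *; rewrite lee_fin.
- exact: finite_finset.
have -> : [set: J] = [set` index_enum J].
  by apply/seteqP; split => j //= _; rewrite mem_index_enum.
by rewrite -fsbig_seq ?index_enum_uniq// sumEFin.
Qed.
End asum.

Section usum.
Variable R : realType.

Definition abs_summable (I : choiceType) (f : I -> R) : Prop :=
  (asum (fun x => `|f x|%R) < +oo)%E.

Section basic.
Variable I : choiceType.
Implicit Types f g p q : I -> R.

Lemma asum_lty_le f g : (forall x, f x <= g x) ->
  (asum g < +oo)%E -> (asum f < +oo)%E.
Proof. by move=> fg; apply: le_lt_trans; exact: le_asum. Qed.

Lemma asum_fineK f : (forall x, 0 <= f x) -> (asum f < +oo)%E ->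
  (fine (asum f))%:E = asum f.
Proof. by move=> f0 fy; rewrite fineK// ge0_fin_numE// asum_ge0. Qed.

Lemma asumD_lty f g : (forall x, 0 <= f x) -> (forall x, 0 <= g x) ->
  (asum f < +oo)%E -> (asum g < +oo)%E -> (asum (fun x => (f x + g x)%R) < +oo)%E.
Proof. by move=> f0 g0 fy gy; rewrite asumD// lte_add_pinfty. Qed.

Lemma asumZ_lty (c : R) f : 0 <= c -> (forall x, 0 <= f x) ->
  (asum f < +oo)%E -> (asum (fun x => (c * f x)%R) < +oo)%E.
Proof. by move=> c0 f0 fy; rewrite asumZ// -asum_fineK// -EFinM ltry. Qed.

Lemma asum0 : asum (fun _ : I => 0 : R) = 0%E :> \bar R.
Proof. by rewrite /asum esum1. Qed.

(** Any decomposition into summable nonnegative parts computes [usum]: [fp - fn = p - q] becomes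
    [fp + q = p + fn], where additivity of nonnegative sums applies. Linearity of [usum] then
    follows by adding or scaling decompositions. *)
Lemma usum_sub f p q : (forall x, 0 <= p x) -> (forall x, 0 <= q x) ->
  (asum p < +oo)%E -> (asum q < +oo)%E -> f =1 (fun x => p x - q x) ->
  usum f = fine (asum p) - fine (asum q).
Proof.
move=> p0 q0 py qy fE.
pose fp x := Num.max (f x) 0; pose fn x := Num.max (- f x) 0.
have fp0 x : 0 <= fp x by rewrite le_max lexx orbT.
have fn0 x : 0 <= fn x by rewrite le_max lexx orbT.
have fpy : (asum fp < +oo)%E.
  apply: asum_lty_le py => x; rewrite ge_max p0 andbT fE.
  by have := q0 x; lra.
have fny : (asum fn < +oo)%E.
  apply: asum_lty_le qy => x; rewrite ge_max q0 andbT fE.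
  by have := p0 x; lra.
have : asum (fun x => fp x + q x) = asum (fun x => p x + fn x).
  congr asum; apply/funext => x; rewrite /fp /fn fE.
  by case: (leP (p x - q x) 0); case: (leP (- (p x - q x)) 0); lra.
rewrite !asumD// -(asum_fineK fp0 fpy) -(asum_fineK fn0 fny).
rewrite -(asum_fineK p0 py) -(asum_fineK q0 qy) -!EFinD => -[].
rewrite /usum -/(asum fp) -/(asum fn); lra.
Qed.

Lemma ge0_usum f : (forall x, 0 <= f x) -> (asum f < +oo)%E ->
  usum f = fine (asum f).
Proof.
move=> f0 fy; rewrite (usum_sub f0 (fun x => lexx 0) fy); first last.
- by move=> x; rewrite subr0.
- by rewrite asum0.
by rewrite asum0 subr0.
Qed.

Lemma abs_summableP f : abs_summable f -> exists p q,
  [/\ (forall x, 0 <= p x), (forall x, 0 <= q x), (asum p < +oo)%E,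
      (asum q < +oo)%E & f =1 (fun x => p x - q x)].
Proof.
move=> sf; exists (fun x => Num.max (f x) 0), (fun x => Num.max (- f x) 0).
split => [x|x|||x]; rewrite ?le_max ?lexx ?orbT//.
- by apply: asum_lty_le sf => x; rewrite ge_max ler_norm normr_ge0.
- by apply: asum_lty_le sf => x; rewrite ge_max -normrN ler_norm normr_ge0.
by case: (leP (f x) 0); case: (leP (- f x) 0); lra.
Qed.

Lemma abs_summable_le f g : (forall x, `|f x| <= g x) -> (asum g < +oo)%E ->
  abs_summable f.
Proof. exact: asum_lty_le. Qed.

Lemma abs_summableD f g : abs_summable f -> abs_summable g ->
  abs_summable (fun x => f x + g x).
Proof.
move=> sf sg; apply: (abs_summable_le (g := fun x => `|f x| + `|g x|)).
  by move=> x; exact: ler_normD.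
by apply: asumD_lty => // x.
Qed.

Lemma abs_summableZ c f : abs_summable f -> abs_summable (fun x => c * f x).
Proof.
move=> sf; apply: (abs_summable_le (g := fun x => `|c| * `|f x|)).
  by move=> x; rewrite normrM.
by apply: asumZ_lty => // x.
Qed.

Lemma usumD f g : abs_summable f -> abs_summable g ->
  usum (fun x => f x + g x) = usum f + usum g.
Proof.
move=> /abs_summableP[p [q [p0 q0 py qy fE]]].
move=> /abs_summableP[p' [q' [p'0 q'0 p'y q'y gE]]].
rewrite (usum_sub p0 q0 py qy fE) (usum_sub p'0 q'0 p'y q'y gE).
rewrite (@usum_sub _ (fun x => p x + p' x) (fun x => q x + q' x)).
- rewrite !asumD// !fineD; first lra;
  by rewrite ge0_fin_numE// asum_ge0.
- by move=> x; rewrite addr_ge0.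
- by move=> x; rewrite addr_ge0.
- exact: asumD_lty.
- exact: asumD_lty.
- by move=> x; rewrite fE gE; lra.
Qed.

Lemma usumN f : abs_summable f -> usum (fun x => - f x) = - usum f.
Proof.
move=> /abs_summableP[p [q [p0 q0 py qy fE]]].
rewrite (usum_sub p0 q0 py qy fE) opprB; apply: usum_sub => // x.
by rewrite fE opprB.
Qed.

Lemma usumZ c f : abs_summable f -> usum (fun x => c * f x) = c * usum f.
Proof.
wlog c0 : c / 0 <= c => [H sf|/abs_summableP[p [q [p0 q0 py qy fE]]]].
  have [|/ltW c0] := leP 0 c; first by move=> /H; exact.
  rewrite -[c]opprK mulNr -H ?oppr_ge0// -usumN; last exact: abs_summableZ.
  by congr usum; apply/funext => x; rewrite mulNr.
rewrite (usum_sub p0 q0 py qy fE).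
rewrite (@usum_sub _ (fun x => c * p x) (fun x => c * q x)).
- rewrite !asumZ// -(asum_fineK p0 py) -(asum_fineK q0 qy) -!EFinM/=; lra.
- by move=> x; rewrite mulr_ge0.
- by move=> x; rewrite mulr_ge0.
- exact: asumZ_lty.
- exact: asumZ_lty.
- by move=> x; rewrite fE mulrBr.
Qed.

Lemma usum0 : usum (fun _ : I => 0 : R) = 0.
Proof. by rewrite ge0_usum ?asum0. Qed.

Lemma abs_summable0 : @abs_summable I (fun=> 0).
Proof.
by rewrite /abs_summable (_ : (fun=> _) = fun=> 0) ?asum0// normr0.
Qed.

Lemma abs_summable_sum (J : Type) (s : seq J) (P : pred J) (F : J -> I -> R) :
  (forall j, abs_summable (F j)) ->
  abs_summable (fun x => \sum_(j <- s | P j) F j x).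
Proof.
move=> sF; elim: s => [|j s IH].
  under [X in abs_summable X]funext do rewrite big_nil.
  exact: abs_summable0.
under [X in abs_summable X]funext do rewrite big_cons.
by case: (P j) => //; exact: abs_summableD.
Qed.

Lemma usum_sum (J : Type) (s : seq J) (P : pred J) (F : J -> I -> R) :
  (forall j, abs_summable (F j)) ->
  usum (fun x => \sum_(j <- s | P j) F j x) = \sum_(j <- s | P j) usum (F j).
Proof.
move=> sF; elim: s => [|j s IH].
  by rewrite big_nil -[RHS]usum0; congr usum; apply/funext => x; rewrite big_nil.
rewrite big_cons -IH; case: ifPn => Pj.
  rewrite -usumD//; last exact: abs_summable_sum.
  by congr usum; apply/funext => x; rewrite big_cons Pj.
by congr usum; apply/funext => x; rewrite big_cons (negbTE Pj).
Qed.

Lemma reindex_usum (J : choiceType) (h : J -> I) f : bijective h ->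
  usum (fun x => f (h x)) = usum f.
Proof.
move=> bh; rewrite /usum.
congr (fine _ - fine _).
  exact: (reindex_asum (fun x => Num.max (f x) 0) bh).
exact: (reindex_asum (fun x => Num.max (- f x) 0) bh).
Qed.

Lemma usum_single f x0 : (forall x, x != x0 -> f x = 0) -> usum f = f x0.
Proof.
have key (a : I -> R) : (forall x, x != x0 -> a x = 0) -> 0 <= a x0 ->
    asum a = (a x0)%:E.
  move=> a0 ax0; rewrite -[RHS]/((EFin \o a) x0).
  rewrite -(esum_set1 (a := EFin \o a)) ?lee_fin//.
  rewrite /asum [RHS]esum_mkcond; apply: eq_esum => x _.
  by case: ifPn => //; rewrite notin_setE => /eqP /a0 ->.
move=> f0; rewrite /usum -/(asum (fun x => Num.max (f x) 0)).
rewrite -/(asum (fun x => Num.max (- f x) 0)) !key ?le_max ?lexx ?orbT//.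
- by move=> /=; case: (leP (f x0) 0); case: (leP (- f x0) 0); lra.
- by move=> x /f0 ->; rewrite oppr0 maxxx.
- by move=> x /f0 ->; rewrite maxxx.
Qed.

End basic.

Lemma usum_prod (I : choiceType) (J : finType) (f : I * J -> R) :
  abs_summable f -> (forall j, abs_summable (fun x => f (x, j))) /\
  usum f = \sum_(j : J) usum (fun x => f (x, j)).
Proof.
move=> /[dup] sf; rewrite /abs_summable asum_prod// => fy.
have fj j : abs_summable (fun x => f (x, j)).
  apply: le_lt_trans fy.
  by rewrite (bigD1 j)//= leeDl// sume_ge0// => i _; exact: asum_ge0.
split=> //; have [p [q [p0 q0 py qy fE]]] := abs_summableP sf.
rewrite (usum_sub p0 q0 py qy fE) !asum_prod//.
have fin r : (forall x, 0 <= r x) -> (asum r < +oo)%E ->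
    forall j : J, (asum (fun x : I => r (x, j)) < +oo)%E.
  move=> r0 ry j; apply: le_lt_trans ry; rewrite asum_prod//.
  by rewrite (bigD1 j)//= leeDl// sume_ge0// => i _; exact: asum_ge0.
rewrite -!sum_fine; first last.
- by move=> j _; rewrite ge0_fin_numE ?asum_ge0// fin.
- by move=> j _; rewrite ge0_fin_numE ?asum_ge0// fin.
rewrite -sumrB; apply: eq_bigr => j _.
by apply/esym/usum_sub => //; exact: fin.
Qed.

End usum.

(** * Geometry of l2 *)

Section l2_space.
Variables (R : realType) (I : choiceType).
Implicit Types f g h u w : I -> R.

Local Notation nrm2 f := (l2_inner f f).
Local Notation l2 := (@l2 R I).

Lemma l2_le f g : (forall x, f x ^+ 2 <= g x) -> (asum g < +oo)%E -> l2 f.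
Proof. exact: asum_lty_le. Qed.

Lemma l2_asum f : l2 f -> (asum (fun x => (f x ^+ 2)%R) < +oo)%E.
Proof. by []. Qed.

Lemma l2D f g : l2 f -> l2 g -> l2 (fun x => f x + g x).
Proof.
move=> /l2_asum lf /l2_asum lg.
apply: (@l2_le _ (fun x => 2 * f x ^+ 2 + 2 * g x ^+ 2)).
  by move=> x; exact: sqrD_le.
have sq0 h x : 0 <= 2 * h x ^+ 2 by rewrite mulr_ge0 ?sqr_ge0.
by apply: asumD_lty => //; apply: asumZ_lty => // x; rewrite sqr_ge0.
Qed.

Lemma l2Z c f : l2 f -> l2 (fun x => c * f x).
Proof.
move=> lf; apply: (@l2_le _ (fun x => c ^+ 2 * f x ^+ 2)).
  by move=> x; rewrite exprMn.
by apply: asumZ_lty => // [|x]; rewrite sqr_ge0.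
Qed.

Lemma l2N f : l2 f -> l2 (fun x => - f x).
Proof. by move=> /(l2Z (-1)); under [X in l2 X]funext do rewrite mulN1r. Qed.

Lemma l2B f g : l2 f -> l2 g -> l2 (fun x => f x - g x).
Proof. by move=> lf lg; apply: l2D => //; exact: l2N. Qed.

Lemma l2_zero : l2 (fun=> 0).
Proof. by apply: (@l2_le _ (fun=> 0)); rewrite ?asum0// => x; rewrite expr0n. Qed.

Lemma l2_l2_delta x : l2 (l2_delta R x).
Proof.
apply: le_lt_trans (ltry 1).
apply: asum_le_fset => s us; rewrite /l2_delta.
have [xs|xs] := boolP (x \in s).
  rewrite (bigD1_seq x)//= eqxx expr1n big1 ?addr0// => y /negbTE ->.
  by rewrite expr0n.
rewrite big_seq big1// => y ys; rewrite (_ : (y == x) = false) ?expr0n//.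
by apply: contraNF xs => /eqP <-.
Qed.

Lemma inner_abs_summable f g : l2 f -> l2 g -> abs_summable (f \* g).
Proof.
move=> lf lg; apply: (@abs_summable_le _ _ _ (fun x => f x ^+ 2 + g x ^+ 2)).
  move=> x /=; rewrite ler_norml.
  by have := sqr_ge0 (f x - g x); have := sqr_ge0 (f x + g x); nra.
by apply: asumD_lty => // x; rewrite sqr_ge0.
Qed.

Lemma eq_nrm2 f g : f =1 g -> nrm2 f = nrm2 g.
Proof. by move=> /funext ->. Qed.

Lemma eq_innerl f g h : f =1 g -> l2_inner f h = l2_inner g h.
Proof. by move=> /funext ->. Qed.

Lemma innerC f g : l2_inner f g = l2_inner g f.
Proof. by congr usum; apply/funext => x /=; rewrite mulrC. Qed.

Lemma innerDl f g h : l2 f -> l2 g -> l2 h ->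
  l2_inner (fun x => f x + g x) h = l2_inner f h + l2_inner g h.
Proof.
move=> lf lg lh; rewrite /l2_inner -usumD; try exact: inner_abs_summable.
by congr usum; apply/funext => x /=; rewrite mulrDl.
Qed.

Lemma innerZl c f h : l2 f -> l2 h ->
  l2_inner (fun x => c * f x) h = c * l2_inner f h.
Proof.
move=> lf lh; rewrite /l2_inner -usumZ; try exact: inner_abs_summable.
by congr usum; apply/funext => x /=; rewrite mulrA.
Qed.

Lemma innerNl f h : l2 f -> l2 h -> l2_inner (fun x => - f x) h = - l2_inner f h.
Proof.
move=> lf lh; rewrite -mulN1r -(innerZl (-1) lf lh).
by congr (l2_inner _ h); apply/funext => x; rewrite mulN1r.
Qed.

Lemma innerBl f g h : l2 f -> l2 g -> l2 h ->
  l2_inner (fun x => f x - g x) h = l2_inner f h - l2_inner g h.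
Proof.
move=> lf lg lh; by rewrite innerDl//; [rewrite innerNl|exact: l2N].
Qed.

Lemma inner_sumr (J : Type) (s : seq J) (P : pred J) f (F : J -> I -> R) :
  l2 f -> (forall j, l2 (F j)) ->
  l2_inner f (fun x => \sum_(j <- s | P j) F j x) =
  \sum_(j <- s | P j) l2_inner f (F j).
Proof.
move=> lf lF; rewrite /l2_inner -usum_sum.
  by congr usum; apply/funext => x /=; rewrite mulr_sumr.
by move=> j; exact: inner_abs_summable.
Qed.

Lemma inner_fineE f : l2 f -> nrm2 f = fine (asum (fun x => f x ^+ 2)).
Proof.
move=> lf; rewrite /l2_inner ge0_usum.
- by congr (fine (asum _)); apply/funext => x /=; rewrite expr2.
- by move=> x /=; rewrite -expr2 sqr_ge0.
- by under [X in asum X]funext do rewrite /= -expr2.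
Qed.

Lemma nrm2K f : l2 f -> (nrm2 f)%:E = asum (fun x => (f x ^+ 2)%R).
Proof. by move=> lf; rewrite inner_fineE// asum_fineK// => x; rewrite sqr_ge0. Qed.

Lemma nrm2_ge0 f : l2 f -> 0 <= nrm2 f.
Proof.
by move=> lf; rewrite -lee_fin nrm2K//; apply: asum_ge0 => x; rewrite sqr_ge0.
Qed.

Lemma nrm2_ge f x : l2 f -> f x ^+ 2 <= nrm2 f.
Proof.
move=> lf; rewrite -lee_fin nrm2K//.
by apply: (asum_ge (a := fun x => f x ^+ 2)) => y; rewrite sqr_ge0.
Qed.

Lemma nrm2_eq0 f : l2 f -> nrm2 f = 0 -> f = fun=> 0.
Proof.
move=> lf f0; apply/funext => x; apply/eqP; rewrite -sqrf_eq0 eq_le sqr_ge0 andbT.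
by rewrite -f0; exact: nrm2_ge.
Qed.

Lemma l2_delta_inner f x : l2_inner f (l2_delta R x) = f x.
Proof.
rewrite /l2_inner (usum_single (x0 := x)) /l2_delta/= ?eqxx ?mulr1//.
by move=> y /negbTE ->; rewrite mulr0.
Qed.

Lemma nrm2DZ f g t : l2 f -> l2 g ->
  nrm2 (fun x => f x + t * g x) =
  nrm2 f + 2 * t * l2_inner f g + t ^+ 2 * nrm2 g.
Proof.
move=> lf lg; have ltg := l2Z t lg.
have EL k : l2 k -> l2_inner (fun x => f x + t * g x) k =
    l2_inner f k + t * l2_inner g k.
  by move=> lk; rewrite innerDl// innerZl.
rewrite EL; last exact: l2D.
rewrite (innerC f) (innerC g (fun x => _)) !EL// (innerC g f).
by rewrite expr2; ring.
Qed.

Lemma cauchy_schwarz f g : l2 f -> l2 g ->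
  l2_inner f g ^+ 2 <= nrm2 f * nrm2 g.
Proof.
move=> lf lg; apply: discriminant_le; first exact: nrm2_ge0.
by move=> t; rewrite -nrm2DZ//; apply/nrm2_ge0/l2D => //; exact: l2Z.
Qed.

Definition l2_closure (W : set (I -> R)) : set (I -> R) :=
  [set q | l2 q /\ forall e, 0 < e ->
     exists w, [/\ W w, l2 w & nrm2 (fun x => q x - w x) < e]].

Lemma inner_closure W q g : l2_closure W q -> l2 g ->
  (forall w, W w -> l2_inner w g = 0) -> l2_inner q g = 0.
Proof.
move=> [lq Wq] lg Wg; apply/eqP; rewrite -sqrf_eq0 eq_le sqr_ge0 andbT.
apply/ler_addgt0Pl => e e0; rewrite addr0.
have g0 := nrm2_ge0 lg.
have [|w [/Wg wg lw]] := Wq (e / (nrm2 g + 1)).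
  by rewrite divr_gt0// ltr_wpDl.
move=> /ltW; rewrite ler_pdivlMr ?ltr_wpDl// => qw.
have := cauchy_schwarz (l2B lq lw) lg; rewrite innerBl// wg subr0 => cs.
apply: (le_trans cs); apply: le_trans qw; rewrite ler_wpM2l ?lerDl ?ler01//.
exact/nrm2_ge0/l2B.
Qed.

End l2_space.

(** * Completeness of l2 and orthogonal projection *)

Section l2_projection.
Variables (R : realType) (I : choiceType).
Implicit Types f g u w : I -> R.

Local Notation nrm2 f := (l2_inner f f).
Local Notation l2 := (@l2 R I).
Local Notation eps n := ((n.+1%:R : R)^-1).

Lemma exists_natSinv_lt (e : R) : 0 < e -> exists n, eps n < e.
Proof.
move=> e0; have [N _ HN] := near_infty_natSinv_lt (PosNum e0).
by exists N; exact: (HN N (leqnn N)).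
Qed.

(** The limit is taken pointwise, each coordinate being controlled by the norm. Finite partial sums
    of the squared differences pass to the limit and keep the bound. The rate is the one that
    minimizing sequences provide. *)
Lemma l2_complete (wn : nat -> I -> R) : (forall n, l2 (wn n)) ->
  (forall n k, (n <= k)%N -> nrm2 (fun x => wn n x - wn k x) <= 4 * eps n) ->
  exists q, l2 q /\ forall n, nrm2 (fun x => q x - wn n x) <= 4 * eps n.
Proof.
move=> lw wC; have cw x : cvg (wn ^~ x @ \oo).
  apply: cauchy_cvg; apply: cauchy_exP => e e0.
  have [|n ne] := @exists_natSinv_lt (e ^+ 2 / 4); first by rewrite divr_gt0 ?exprn_gt0.
  exists (wn n x); exists n => // k /= nk.
  rewrite /ball/= -(ltr_pXn2r (n := 2)) ?nnegrE ?normr_ge0 ?(ltW e0)//.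
  rewrite -normrX ger0_norm ?sqr_ge0//.
  apply: le_lt_trans (nrm2_ge x (l2B (lw n) (lw k))) _.
  by apply: le_lt_trans (wC _ _ nk) _; rewrite mulrC -ltr_pdivlMr.
pose q x := limn (wn ^~ x).
have qle n : (asum (fun x => ((q x - wn n x) ^+ 2)%R) <= (4 * eps n)%:E)%E.
  apply: asum_le_fset => s us.
  have cs : \sum_(x <- s) (wn k x - wn n x) ^+ 2 @[k --> \oo] -->
      \sum_(x <- s) (q x - wn n x) ^+ 2.
    apply: cvg_big => [|x _]; first exact: add_continuous.
    under eq_fun do rewrite expr2; rewrite expr2.
    by apply: cvgM; apply: cvgB; do ?[exact: cw|exact: cvg_cst].
  apply: (cvgr_to_le cs); exists n => // k /= nk.
  rewrite -lee_fin.
  apply: (@le_trans _ _ (asum (fun x => (wn n x - wn k x) ^+ 2))).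
    apply: le_trans (fset_le_asum _ us); last by move=> x; rewrite sqr_ge0.
    by rewrite lee_fin; apply: ler_sum => x _; rewrite -sqrrN opprB.
  by rewrite -nrm2K ?lee_fin ?wC//; exact: l2B.
have lqw n : l2 (fun x => q x - wn n x).
  by apply: le_lt_trans (qle n) (ltry _).
exists q; split=> [|n]; last by rewrite -lee_fin nrm2K.
have := l2D (lqw 0%N) (lw 0%N).
by under [X in l2 X]funext do rewrite subrK.
Qed.

(** [W] need not be closed, so the point nearest to [u] is the limit of a minimizing sequence and is
    only found in the closure. *)
Lemma l2_projection (W : set (I -> R)) u :
  l2 u -> (forall w, W w -> l2 w) -> W (fun=> 0) ->
  (forall t f g, W f -> W g -> W (fun x => f x + t * g x)) ->
  exists q, l2_closure W q /\
    forall w, W w -> l2_inner (fun x => u x - q x) w = 0.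
Proof.
move=> lu Wl W0 WD.
pose D := [set nrm2 (fun x => u x - w x) | w in W].
have lbD : lbound D 0 by move=> _ [w /Wl lw <-]; exact/nrm2_ge0/l2B.
have infD : has_inf D by split; [exists (nrm2 (fun x => u x - 0)), (fun=> 0)|exists 0].
pose m := inf D.
have mle w : W w -> m <= nrm2 (fun x => u x - w x).
  by move=> Ww; apply: (ge_inf infD.2); exists w.
have /choice[wn wnP] n : exists w, W w /\ nrm2 (fun x => u x - w x) < m + eps n.
  have [|_ [w Ww <-] wm] := @inf_adherent _ D (eps n) _ infD.
    by rewrite invr_gt0.
  by exists w.
have Wwn n := (wnP n).1; have lwn n := Wl _ (Wwn n).
have luw n : l2 (fun x => u x - wn n x) by exact: l2B.
have e0 n : 0 < eps n by rewrite invr_gt0.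
(* Parallelogram argument: the midpoint of [wn n] and [wn k] lies in [W], so its squared distance to
   [u] is at least [m]. This bounds the squared gap by [2 * (eps n + eps k)]. *)
have near n k : (n <= k)%N -> nrm2 (fun x => wn n x - wn k x) <= 4 * eps n.
  move=> nk; have lb : l2 (fun x => wn n x - wn k x) by exact: l2B.
  have Wmid : W (fun x => wn n x + (1 / 2) * (wn k x + -1 * wn n x)).
    exact: (WD _ _ _ (Wwn n) (WD _ _ _ (Wwn k) (Wwn n))).
  have E1 : nrm2 (fun x => u x - wn k x) =
      nrm2 (fun x => (u x - wn n x) + 1 * (wn n x - wn k x)).
    by apply: eq_nrm2 => x; ring.
  have E2 : nrm2 (fun x => u x - (wn n x + (1 / 2) * (wn k x + -1 * wn n x))) =
      nrm2 (fun x => (u x - wn n x) + (1 / 2) * (wn n x - wn k x)).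
    by apply: eq_nrm2 => x; field.
  have := mle _ Wmid; have := (wnP n).2; have := (wnP k).2.
  rewrite E1 E2 !nrm2DZ//.
  have : eps k <= eps n by rewrite lef_pV2 ?posrE// ler_nat.
  move: (eps k) (eps n) => ek en; rewrite expr1n mul1r mulr1.
  set a := nrm2 _; set b := l2_inner _ _; set c := nrm2 _.
  rewrite (_ : (1 / 2 : R) ^+ 2 = 1 / 4); last by field.
  by lra.
have [q [lq qn]] := l2_complete lwn near.
exists q; split=> [|w Ww].
  split=> // e ep; have [|n ne] := @exists_natSinv_lt (e / 4).
    by rewrite divr_gt0.
  exists (wn n); split => //; apply: le_lt_trans (qn n) _.
  by rewrite mulrC -ltr_pdivlMr.
have lw := Wl _ Ww; have w0 := nrm2_ge0 lw.
(* Near-minimality of [wn n] makes [eps n + 2 t b + t^2 c] nonnegative for all [t], with [b] the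
   inner product and [c] the squared norm of [w]. *)
have almost n : l2_inner (fun x => u x - wn n x) w ^+ 2 <= eps n * nrm2 w.
  apply: discriminant_le => // t.
  have := mle _ (WD (- t) _ _ (Wwn n) Ww); have := (wnP n).2.
  have -> : nrm2 (fun x => u x - (wn n x + - t * w x)) =
      nrm2 (fun x => (u x - wn n x) + t * w x).
    by apply: eq_nrm2 => x; ring.
  rewrite nrm2DZ//; move: (eps n) => en.
  by set a := nrm2 _; set b := l2_inner _ _; set c := nrm2 _; nra.
(* The constant is [10 = 2 * 1 + 2 * 4]: [1] from [almost], [4] from Cauchy-Schwarz and the rate of
   convergence. *)
have bound n : l2_inner (fun x => u x - q x) w ^+ 2 <= 10 * nrm2 w * eps n.
  have -> : l2_inner (fun x => u x - q x) w =
      l2_inner (fun x => u x - wn n x) w - l2_inner (fun x => q x - wn n x) w.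
    by rewrite !innerBl//; ring.
  have := almost n.
  have : l2_inner (fun x => q x - wn n x) w ^+ 2 <= 4 * eps n * nrm2 w.
    apply: le_trans (cauchy_schwarz (l2B lq (lwn n)) lw) _.
    by rewrite ler_wpM2r.
  move: (l2_inner (fun x => q x - wn n x) w) => a.
  move: (l2_inner (fun x => u x - wn n x) w) => b.
  move: (eps n) (nrm2 w) => en c.
  by have := sqr_ge0 (a + b); rewrite sqrrD sqrrB; lra.
apply/eqP; rewrite -sqrf_eq0 eq_le sqr_ge0 andbT leNgt; apply/negP => c0.
set c := (X in 0 < X) in c0.
have [|n] := @exists_natSinv_lt (c / (10 * nrm2 w + 1)).
  by rewrite divr_gt0// ltr_wpDl// mulr_ge0.
rewrite ltr_pdivlMr; last by rewrite ltr_wpDl// mulr_ge0.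
have := bound n; rewrite -/c; have := e0 n.
by move: (eps n) c {c0} (nrm2 w) => en c C; nra.
Qed.

End l2_projection.

(** * Gradients, walks and the first l2-homology *)

Section orthogonal_complement.
Variables (R : realType) (I : choiceType) (A : set (I -> R)).
Hypotheses (Al2 : forall a, A a -> l2 a) (A0 : A (fun=> 0)).
Hypothesis AD : forall t f g, A f -> A g -> A (fun x => f x + t * g x).

(** The projection onto the complement of [A] is [u - q], with [q] the projection of [u] to the
    closure of [A]. This witness keeps [xget] away from its default. *)
Lemma l2_proj_orthogonal u :
  let V := [set f | l2 f /\ forall a, A a -> l2_inner f a = 0] in
  let p := l2_proj V u in l2 u ->
  V p /\ forall v, V v -> l2_inner u v = l2_inner p v.
Proof.
move=> V p lu; have [q [qA qorth]] := l2_projection lu Al2 A0 AD.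
have lq : l2 q by case: qA.
suff [Vp pV] : V p /\ forall v, V v -> l2_inner (u \- p) v = 0.
  split=> // v Vv; apply/eqP; rewrite -subr_eq0 -innerBl//.
  - by rewrite pV.
  - by case: Vp.
  - by case: Vv.
apply: (@xgetPex _ (fun=> 0)
  [set p | V p /\ forall v, V v -> l2_inner (u \- p) v = 0]).
exists (fun x => u x - q x).
split=> [|v [lv vA]]; first by split=> //; exact: l2B.
rewrite (_ : _ \- _ = q); last by apply/funext => x /=; rewrite opprB addrC subrK.
by apply: (inner_closure qA) => // w Aw; rewrite innerC vA.
Qed.

End orthogonal_complement.

Section l2_group.
Variables (R : realType) (G : groupType).
Implicit Types g : G.

Lemma mulg_bijective g : bijective (fun x : G => (x * g)%g).
Proof. by exists (fun x => (x * g^-1)%g) => x; rewrite ?mulgK ?mulgVK. Qed.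

Lemma l2_mulr (f : G -> R) g : l2 f -> l2 (fun x => f (x * g)%g).
Proof.
move=> lf; have := reindex_asum (fun x => f x ^+ 2) (mulg_bijective g).
by rewrite /= => E; rewrite /l2/= -/(asum (fun x => (f (x * g)%g ^+ 2)%R)) E.
Qed.

Lemma inner_mulr (f h : G -> R) g :
  l2_inner f (fun x => h (x * g)%g) = l2_inner (fun x => f (x * g^-1)%g) h.
Proof.
rewrite [RHS]/l2_inner -[RHS](reindex_usum _ (mulg_bijective g)).
by congr usum; apply/funext => x /=; rewrite mulgK.
Qed.

Lemma l2_prodP (J : finType) (f : G * J -> R) :
  l2 f <-> forall j, l2 (fun x => f (x, j)).
Proof.
rewrite /l2/= -/(asum (fun x => (f x ^+ 2)%R)) asum_prod; last first.
  by move=> x; rewrite sqr_ge0.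
split=> [fy j|fy]; last first.
  by apply: lte_sum_pinfty => j _; exact: fy.
apply: le_lt_trans fy; rewrite -/(asum (fun x => (f (x, j) ^+ 2)%R)).
rewrite (bigD1 j)//= leeDl// sume_ge0// => i _.
by apply: asum_ge0 => x; rewrite sqr_ge0.
Qed.

Lemma inner_prod (J : finType) (f h : G * J -> R) : l2 f -> l2 h ->
  l2_inner f h = \sum_(j : J) l2_inner (fun x => f (x, j)) (fun x => h (x, j)).
Proof.
by move=> lf lh; rewrite /l2_inner (usum_prod (inner_abs_summable lf lh)).2.
Qed.

End l2_group.

Lemma l2_sum (R : realType) (I : choiceType) (J : Type) (s : seq J) (P : pred J)
    (F : J -> I -> R) :
  (forall j, P j -> l2 (F j)) -> l2 (fun x => \sum_(j <- s | P j) F j x).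
Proof.
move=> lF; elim: s => [|j s IH].
  by under [X in l2 X]funext do rewrite big_nil; exact: l2_zero.
under [X in l2 X]funext do rewrite big_cons.
by case: (boolP (P j)) => // Pj; apply: l2D => //; exact: lF.
Qed.

Section gradient.
Variables (R : realType) (G : groupType) (n : nat) (s : 'I_n -> G).
Implicit Types (u v h : G -> R) (f : G * 'I_n -> R) (w : word 'I_n).

Definition grad h : G * 'I_n -> R := fun e => h (e.1 * s e.2)%g - h e.1.

Definition energy u : \bar R := asum (fun e => (grad u e ^+ 2)%R).

(* [u] represents a nonzero class in the space of l2 gradients modulo the closure
   of the gradients of l2 functions. *)
Definition energy_gap := exists u, (energy u < +oo)%E /\
  exists2 e : R, 0 < e &
    forall v, l2 v -> (e%:E <= energy (fun x => (u x - v x)%R))%E.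

Lemma l2_grad v : l2 v -> l2 (grad v).
Proof.
by move=> lv; apply/l2_prodP => i; exact: l2B (l2_mulr (s i) lv) lv.
Qed.

(** The edge [(y, i)] runs from [y] to [y * s i], so reading an inverse letter at [x] crosses
    backwards an edge that ends at [x]. [walk_sum] is the resulting integral of the cochain [f]
    along a walk. *)
Definition edge_val f x (l : 'I_n * bool) : R :=
  if l.2 then - f ((x * (s l.1)^-1)%g, l.1) else f (x, l.1).

Fixpoint walk_sum f x (w : seq ('I_n * bool)) : R :=
  if w is l :: w' then edge_val f x l + walk_sum f (x * letter_eval s l)%g w'
  else 0.

Lemma word_eval_nil : word_eval s [::] = 1%g.
Proof. by rewrite /word_eval big_nil. Qed.

Lemma word_eval_cons l w : word_eval s (l :: w) = (letter_eval s l * word_eval s w)%g.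
Proof. by rewrite /word_eval big_cons. Qed.

Lemma word_eval_cat w w' : word_eval s (w ++ w') = (word_eval s w * word_eval s w')%g.
Proof. by rewrite /word_eval big_cat. Qed.

Lemma walk_sum_cat f x w w' :
  walk_sum f x (w ++ w') = walk_sum f x w + walk_sum f (x * word_eval s w)%g w'.
Proof.
elim: w x => [|l w IH] x /=; first by rewrite add0r word_eval_nil mulg1.
by rewrite IH addrA word_eval_cons mulgA.
Qed.

Lemma walk_sum_grad h x w :
  walk_sum (grad h) x w = h (x * word_eval s w)%g - h x.
Proof.
elim: w x => [|[i b] w IH] x /=; first by rewrite word_eval_nil mulg1 subrr.
rewrite IH word_eval_cons mulgA /edge_val /letter_eval /grad.
by case: b => /=; rewrite ?mulgVK; ring.
Qed.

Lemma walk_sumE f x w : walk_sum f x w =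
  \sum_(k < size w) edge_val f (x * word_eval s (take k w))%g (tnth (in_tuple w) k).
Proof.
elim: w x => [|l w IH] x; first by rewrite big_ord0.
rewrite /= big_ord_recl/= word_eval_nil mulg1 IH (tnth_nth l)/=; congr (_ + _).
apply: eq_bigr => k _; rewrite !(tnth_nth l)/= word_eval_cons mulgA.
by [].
Qed.

Definition word_inv (w : word 'I_n) : word 'I_n := rev [seq (l.1, ~~ l.2) | l <- w].

Lemma word_eval_inv w : word_eval s (word_inv w) = (word_eval s w)^-1%g.
Proof.
elim: w => [|[i b] w IH]; first by rewrite word_eval_nil invg1.
rewrite /word_inv/= rev_cons -cats1 word_eval_cat -/(word_inv w) IH.
rewrite !word_eval_cons word_eval_nil mulg1 invgM /letter_eval.
by case: b => //=; rewrite invgK.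
Qed.

Lemma walk_sum_inv f x w :
  walk_sum f (x * word_eval s w)%g (word_inv w) = - walk_sum f x w.
Proof.
elim: w x => [|[i b] w IH] x /=; first by rewrite oppr0.
rewrite /word_inv/= rev_cons -cats1 walk_sum_cat -/(word_inv w).
rewrite word_eval_inv word_eval_cons mulgA IH mulgK.
rewrite /= /edge_val /letter_eval /=.
by case: b => /=; rewrite ?mulgK ?mulgVK; ring.
Qed.

Lemma l2_edge_val f l : l2 f -> l2 (fun x => edge_val f x l).
Proof.
move=> /l2_prodP lf; rewrite /edge_val; case: (l.2); last exact: (lf l.1).
exact: l2N (l2_mulr (s l.1)^-1%g (lf l.1)).
Qed.

Lemma l2_walk_sum f w : l2 f -> l2 (fun x => walk_sum f x w).
Proof.
move=> lf; under [X in l2 X]funext do rewrite walk_sumE.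
apply: l2_sum => k _.
exact: (l2_mulr (word_eval s (take k w)) (l2_edge_val (tnth (in_tuple w) k) lf)).
Qed.

End gradient.

(** * Adjoints of the boundary operators *)

Section presentation.
Variables (R : realType) (G : groupType) (P : finite_presentation G).
Local Notation s := (@gen G P).
Local Notation r := (@rel_word G P).
Implicit Types (f : G * 'I_(ngens P) -> R) (c : G * 'I_(nrels P) -> R).
Implicit Types (h v : G -> R).

(** The cellular coboundary of the 1-cochain [f], evaluated on the 2-cells. *)
Definition loop_sum f : G * 'I_(nrels P) -> R :=
  fun e => walk_sum s f e.1 (r e.2).

Lemma l2_d1_adjoint f v : l2 f -> l2 v ->
  l2_inner f (grad s v) = l2_inner (l2_d1 f) v.
Proof.
move=> lf lv; have fi := (l2_prodP f).1 lf.
have lsv i := l2_mulr (s i) lv; have lsf i := l2_mulr (s i)^-1%g (fi i).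
rewrite inner_prod//; last exact: l2_grad.
rewrite innerC inner_sumr//; last by move=> i; exact: l2B (lsf i) (fi i).
apply: eq_bigr => i _; rewrite innerC (innerC v).
rewrite (innerBl (lsv i) lv (fi i)) (innerBl (lsf i) (fi i) lv).
rewrite -(inner_mulr (fun x => f (x, i))) (innerC v).
by rewrite (innerC (fun x => v (x * s i)%g)).
Qed.

Lemma l2_l2_d2 c : l2 c -> l2 (l2_d2 c).
Proof.
move=> /l2_prodP lc; apply/l2_prodP => i; rewrite /l2_d2/=.
apply: l2_sum => j _.
apply: l2B; apply: l2_sum => k _.
  exact: (l2_mulr (word_eval s (take k (r j)))^-1%g (lc j)).
exact: (l2_mulr (word_eval s (take k.+1 (r j)))^-1%g (lc j)).
Qed.

Lemma l2_loop_sum f : l2 f -> l2 (loop_sum f).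
Proof. by move=> lf; apply/l2_prodP => j; exact: (l2_walk_sum s (r j) lf). Qed.

(** Both sides add up the incidences between 2-cells and edges. The boundary formula groups them by
    generator, the loop sum by position in the relator. *)
Lemma l2_d2_adjoint f c : l2 f -> l2 c ->
  l2_inner f (l2_d2 c) = l2_inner (loop_sum f) c.
Proof.
move=> lf lc; have fi := (l2_prodP f).1 lf; have cj := (l2_prodP c).1 lc.
pose A (i : 'I_(ngens P)) j g :=
  l2_inner (fun x => f (x, i)) (fun x => c ((x * g^-1)%g, j)).
have lcg j g : l2 (fun x => c ((x * g^-1)%g, j)) by exact: (l2_mulr g^-1%g (cj j)).
have -> : l2_inner f (l2_d2 c) = \sum_(j < nrels P) \sum_(i < ngens P)
    (\sum_(k < size (r j) | tnth (in_tuple (r j)) k == (i, false))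
       A i j (word_eval s (take k (r j)))
     - \sum_(k < size (r j) | tnth (in_tuple (r j)) k == (i, true))
       A i j (word_eval s (take k.+1 (r j)))).
  rewrite inner_prod//; last exact: l2_l2_d2.
  rewrite exchange_big/=; apply: eq_bigr => i _; rewrite /l2_d2/=.
  rewrite inner_sumr//; last first.
    by move=> j; apply: l2B; apply: l2_sum => k _; exact: lcg.
  apply: eq_bigr => j _; rewrite innerC innerBl//; first last.
  - by apply: l2_sum => k _; exact: lcg.
  - by apply: l2_sum => k _; exact: lcg.
  by congr (_ - _); rewrite innerC inner_sumr.
rewrite inner_prod//; last exact: l2_loop_sum.
apply: eq_bigr => j _; rewrite sumrB.
(* With the position [k] outermost, only the generator of the letter at [k] contributes to the inner
   sums. *)
rewrite (exchange_big_dep xpredT)//= [X in _ - X](exchange_big_dep xpredT)//=.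
rewrite -sumrB innerC.
rewrite (_ : (fun x => loop_sum f (x, j)) = fun x =>
    \sum_(k < size (r j)) edge_val s f (x * word_eval s (take k (r j)))%g
       (tnth (in_tuple (r j)) k)); last first.
  by apply/funext => x; rewrite /loop_sum walk_sumE.
rewrite inner_sumr//; last first.
  move=> k; have le := l2_edge_val s (tnth (in_tuple (r j)) k) lf.
  exact: (l2_mulr (word_eval s (take k (r j))) le).
apply: eq_bigr => k _.
(* An inverse letter crosses the edge that starts where the letter ends, hence [take k.+1] in the
   negative terms. *)
have : word_eval s (take k.+1 (r j)) =
    (word_eval s (take k (r j)) * letter_eval s (tnth (in_tuple (r j)) k))%g.
  rewrite (take_nth (tnth (in_tuple (r j)) k)) ?ltn_ord// -cats1 word_eval_cat.
  by rewrite -[nth _ _ _](tnth_nth _ (in_tuple (r j))) word_eval_cons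
     word_eval_nil mulg1.
case: (tnth (in_tuple (r j)) k) => i0 b ->; rewrite /edge_val/=.
case: b; rewrite /letter_eval/=.
  rewrite [X in X - _]big1; last by move=> i /eqP.
  rewrite (big_pred1 i0); last by move=> i; rewrite xpair_eqE andbT eq_sym.
  rewrite sub0r /A.
  set p := word_eval _ _.
  transitivity (- l2_inner (fun x => f ((x * (p * (s i0)^-1))%g, i0))
                           (fun x => c (x, j))).
    by congr (- _); rewrite (inner_mulr _ (fun x => c (x, j))) invgK.
  rewrite -(innerNl (l2_mulr (p * (s i0)^-1)%g (fi i0)))//.
  by rewrite [RHS]innerC; apply: eq_innerl => x; rewrite mulgA.
rewrite [X in _ - X]big1; last by move=> i /eqP.
rewrite (big_pred1 i0); last by move=> i; rewrite xpair_eqE andbT eq_sym.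
rewrite subr0 /A (inner_mulr _ (fun x => c (x, j))) invgK.
by rewrite innerC.
Qed.

End presentation.

(** * Reduced homology as harmonic gradients *)

Section first_homology.
Variables (R : realType) (G : groupType) (P : finite_presentation G).
Local Notation s := (@gen G P).
Local Notation r := (@rel_word G P).
Local Notation H1 := (@reduced_l2_H1 R G P).
Implicit Types (f : G * 'I_(ngens P) -> R) (c : G * 'I_(nrels P) -> R).

Lemma word_eval_rel j : word_eval s (r j) = 1%g.
Proof.
apply/rel_complete; apply: pres_sym.
by have := pres_relator r [::] [::] j; rewrite /= cats0.
Qed.

(** Homotopy invariance of the integral of a closed cochain: a cancelling pair crosses one edge back
    and forth, and a relator bounds a 2-cell. *)
Lemma pres_eq_walk_sum f : loop_sum f = (fun=> 0) ->
  forall u v, pres_eq r u v -> word_eval s u = word_eval s v /\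
    forall x, walk_sum s f x u = walk_sum s f x v.
Proof.
move=> f0 u v; elim=> {u v} [w //|v w _ [-> vw]|u v w _ [-> uv] _ [-> vw]
  |u v i b|u v j].
- by split=> // x; rewrite vw.
- by split=> // x; rewrite uv.
- have E : (letter_eval s (i, b) * letter_eval s (i, ~~ b) = 1)%g.
    by rewrite /letter_eval/=; case: b; rewrite ?mulgV ?mulVg.
  split=> [|x].
    by rewrite !word_eval_cat !word_eval_cons word_eval_nil mulg1 E mul1g.
  rewrite !walk_sum_cat; congr (_ + _).
  rewrite !word_eval_cons word_eval_nil mulg1 E mulg1 /= addr0 /edge_val.
  rewrite /letter_eval; case: b {E} => /=; rewrite ?mulgK ?mulgVK.
    by rewrite addNr add0r.
  by rewrite subrr add0r.
- split=> [|x].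
    by rewrite !word_eval_cat word_eval_rel mul1g.
  have := congr1 (@^~ (x * word_eval s u, j)%g) f0; rewrite /loop_sum/= => lj.
  by rewrite !walk_sum_cat lj word_eval_rel mulg1 add0r.
Qed.

Lemma loop_sum_grad (h : G -> R) : loop_sum (grad s h) = (fun=> 0).
Proof.
by apply/funext => -[x j]; rewrite /loop_sum walk_sum_grad word_eval_rel mulg1 subrr.
Qed.

(** Completeness of the relators is simple connectedness of the universal cover: walks with the same
    ends are homotopic, so integrating [f] from [1] along any chosen word defines a potential. *)
Lemma exists_potential f : loop_sum f = (fun=> 0) -> exists h, f = grad s h.
Proof.
move=> f0; have walk_eq u v : word_eval s u = word_eval s v ->
    walk_sum s f 1%g u = walk_sum s f 1%g v.
  move=> uv; have : pres_eq r (u ++ word_inv v) [::].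
    by apply/rel_complete; rewrite word_eval_cat word_eval_inv uv mulgV.
  move=> /(pres_eq_walk_sum f0)[_ /(_ 1%g)].
  rewrite walk_sum_cat uv walk_sum_inv => /eqP.
  by rewrite subr_eq0 => /eqP.
have /choice[wg wgE] := gen_generates P.
exists (fun g => walk_sum s f 1%g (wg g)); apply/funext => -[x i]; rewrite /grad/=.
rewrite (walk_eq _ (wg x ++ [:: (i, false)])).
  by rewrite walk_sum_cat/= wgE mul1g addr0 /edge_val/= addrC addKr.
by rewrite wgE word_eval_cat wgE word_eval_cons word_eval_nil mulg1.
Qed.

Lemma inner0l (I : choiceType) (f : I -> R) : l2_inner (fun=> 0) f = 0.
Proof.
rewrite /l2_inner -[RHS](usum0 R I); congr usum.
by apply/funext => x /=; rewrite mul0r.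
Qed.

Implicit Types (h v : G -> R).

Lemma harmonicP f : l2 f -> (l2_d1 f = (fun=> 0) <->
  forall v, l2 v -> l2_inner f (grad s v) = 0).
Proof.
move=> lf; split=> [f0 v lv|H]; first by rewrite l2_d1_adjoint// f0 inner0l.
apply/funext => y; rewrite -[LHS]l2_delta_inner -l2_d1_adjoint//.
  by apply: H; exact: l2_l2_delta.
exact: l2_l2_delta.
Qed.

Lemma reduced_l2_H1P f : H1 f <->
  [/\ l2 f, l2_d1 f = (fun=> 0) & loop_sum f = (fun=> 0)].
Proof.
split=> [[lf d1f H]|[lf d1f H]]; split=> //.
  apply/funext => e; rewrite -[LHS]l2_delta_inner -l2_d2_adjoint//.
    by apply: H; exact: l2_l2_delta.
  exact: l2_l2_delta.
by move=> c lc; rewrite l2_d2_adjoint// H inner0l.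
Qed.

(** The sum of the images of [l2_d2] and of the adjoint of [l2_d1]. Harmonic chains are the
    complement of this single subspace, the form that [l2_proj_orthogonal] requires. *)
Definition l2_boundaries : set (G * 'I_(ngens P) -> R) :=
  [set a | exists c v, [/\ l2 c, l2 v & a = fun e => l2_d2 c e + grad s v e]].

Lemma l2_d2DZ t c c' e :
  l2_d2 (fun e => c e + t * c' e) e = l2_d2 c e + t * l2_d2 c' e.
Proof.
rewrite /l2_d2 mulr_sumr -big_split/=; apply: eq_bigr => j _.
by rewrite mulrBr !mulr_sumr !big_split/=; ring.
Qed.

Lemma reduced_l2_H1E : H1 =
  [set f | l2 f /\ forall a, l2_boundaries a -> l2_inner f a = 0].
Proof.
apply/seteqP; split=> f.
  move=> [lf d1f H]; split=> // _ [c [v [lc lv ->]]].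
  rewrite innerC innerDl//; [|exact: l2_l2_d2|exact: l2_grad].
  rewrite innerC H// add0r innerC; exact: ((harmonicP lf).1 d1f).
move=> [lf H]; split=> // [|c lc].
  apply/harmonicP => // v lv; apply: H; exists (fun=> 0), v; split=> //.
    exact: l2_zero.
  apply/funext => e; rewrite /l2_d2 big1 ?add0r// => j _.
  by rewrite !big1// subrr.
apply: H; exists c, (fun=> 0); split=> //; first exact: l2_zero.
by apply/funext => e; rewrite /grad subrr addr0.
Qed.

Lemma l2_proj_H1 u : l2 u ->
  let p := l2_proj (H1) u in
  H1 p /\ forall f, H1 f -> l2_inner u f = l2_inner p f.
Proof.
rewrite reduced_l2_H1E; apply: l2_proj_orthogonal.
- move=> _ [c [v [lc lv ->]]]; apply: l2D; [exact: l2_l2_d2|exact: l2_grad].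
- exists (fun=> 0), (fun=> 0); split; try exact: l2_zero.
  apply/funext => e; rewrite /l2_d2 /grad subrr addr0 big1// => j _.
  by rewrite !big1// subrr.
move=> t _ _ [c [v [lc lv ->]]] [c' [v' [lc' lv' ->]]].
exists (fun e => c e + t * c' e), (fun x => v x + t * v' x); split.
- exact: l2D lc (l2Z t lc').
- exact: l2D lv (l2Z t lv').
by apply/funext => e; rewrite l2_d2DZ /grad; ring.
Qed.

Lemma walk_sum_translate f g x w :
  walk_sum s (fun e => f (g * e.1, e.2)%g) x w = walk_sum s f (g * x)%g w.
Proof.
elim: w x => //= l w IH x; rewrite IH mulgA; congr (_ + _).
by rewrite /edge_val/= mulgA.
Qed.

(** Invariance is what allows [vn_dim], which sees only the basis vectors at [1], to detect a chain
    supported elsewhere. *)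
Lemma reduced_l2_H1_translate f g :
  H1 f -> H1 (fun e => f (g * e.1, e.2)%g).
Proof.
move=> /reduced_l2_H1P[lf d1f loopf]; apply/reduced_l2_H1P; split.
- have bij_g : bijective (fun e : G * 'I_(ngens P) => (g * e.1, e.2)%g).
    exists (fun e => (g^-1 * e.1, e.2)%g) => -[x i] /=; first by rewrite mulKg.
    by rewrite mulVKg.
  have := reindex_asum (fun e => f e ^+ 2) bij_g.
  by rewrite /comp => E; apply: l2_le; [move=> e; exact: lexx|rewrite E].
- apply/funext => y; rewrite -[RHS](congr1 (@^~ (g * y)%g) d1f) /l2_d1/=.
  by apply: eq_bigr => i _; rewrite mulgA.
apply/funext => -[x j]; rewrite /loop_sum walk_sum_translate.
by have := congr1 (@^~ ((g * x)%g, j)) loopf.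
Qed.

(** The projection [p i] of the basis vector at [(1, i)] represents evaluation at [(1, i)] on the
    module, and the Betti number is the sum of the squared norms of the [p i]. A nonzero element can
    be translated so as not to vanish at some [(1, i)], which forces [p i] to be nonzero. *)
Lemma l2_betti1_pres_gt0 : 0 < l2_betti1_pres R P <->
  exists f, H1 f /\ f <> (fun=> 0).
Proof.
pose p i := l2_proj (H1) (l2_delta R (1%g, i)).
have pP i := l2_proj_H1 (l2_l2_delta R ((1%g : G), i)).
have lp i : l2 (p i) by case: (pP i) => -[].
have pE f i : H1 f -> f (1%g, i) = l2_inner (p i) f.
  by move=> /(pP i).2 <-; rewrite innerC l2_delta_inner.
have bE : l2_betti1_pres R P = \sum_(i < ngens P) l2_inner (p i) (p i).
  apply: eq_bigr => i _; rewrite -/(p i) innerC; apply: (pP i).2.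
  exact: (pP i).1.
rewrite bE; split=> [|[f [Vf f0]]].
  move=> b0; apply: contrapT => no; move: b0.
  rewrite big1 ?ltxx// => i _; suff -> : p i = fun=> 0 by rewrite inner0l.
  by apply: contrapT => pi0; apply: no; exists (p i); split => //; exact: (pP i).1.
have [g [i fgi]] : exists g i, f (g, i) != 0.
  apply: contrapT => no; apply: f0; apply/funext => -[g i].
  by apply/eqP; apply: contra_notT no => ?; exists g, i.
have pi0 : 0 < l2_inner (p i) (p i).
  rewrite lt_neqAle eq_sym nrm2_ge0// andbT; apply: contraNneq fgi.
  move=> /(nrm2_eq0 (lp i)) pi0.
  have := pE _ i (reduced_l2_H1_translate g Vf); rewrite pi0 inner0l/= mulg1.
  by move=> ->.
rewrite (bigD1 i isT)/=; apply: ltr_pwDl; first exact: pi0.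
by apply: sumr_ge0 => k _; exact: nrm2_ge0 (lp k).
Qed.

Lemma energyE u : l2 (grad s u) ->
  energy s u = (l2_inner (grad s u) (grad s u))%:E :> \bar R.
Proof. by move=> lu; rewrite nrm2K. Qed.

Lemma gradB h v : grad s (fun x => h x - v x) = fun e => grad s h e - grad s v e.
Proof. by apply/funext => e; rewrite /grad; ring. Qed.

(** A gap makes the part of [grad s u] orthogonal to all l2 gradients nonzero. Conversely, a
    harmonic [f] with potential [h] is orthogonal to l2 gradients, so by Pythagoras subtracting an
    l2 function from [h] cannot lower the energy below the squared norm of [f]. *)
Lemma energy_gapP : energy_gap R s <->
  exists f, H1 f /\ f <> (fun=> 0).
Proof.
split=> [[u [lu [e e0 gap]]]|[f [Vf f0]]]; last first.
  have /reduced_l2_H1P[lf d1f loopf] := Vf.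
  have [h fE] := exists_potential loopf; exists h; split.
    by rewrite /energy -fE; exact: l2_asum.
  exists (l2_inner f f).
    rewrite lt_neqAle eq_sym nrm2_ge0// andbT; apply: contra_notN f0.
    by move=> /eqP /nrm2_eq0; exact.
  move=> v lv; have lgv := l2_grad s lv.
  have E : grad s (fun x => h x - v x) = fun e => f e + -1 * grad s v e.
    by rewrite gradB -fE; apply/funext => e; ring.
  rewrite energyE E; last exact: l2D lf (l2Z (-1) lgv).
  rewrite nrm2DZ// ((harmonicP lf).1 d1f v lv) mulr0 addr0 lee_fin.
  by rewrite lerDl mulr_ge0 ?sqr_ge0 ?nrm2_ge0.
have lgu : l2 (grad s u) := lu.
pose W := [set grad s v | v in [set v : G -> R | l2 v]].
have [||t _ _ [v lv <-] [v' lv' <-]|q [qW qorth]] := @l2_projection _ _ W _ lgu.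
- by move=> _ [v lv <-]; exact: l2_grad.
- by exists (fun=> 0); [exact: l2_zero|apply/funext => x; rewrite /grad subrr].
- exists (fun x => v x + t * v' x); first exact: l2D lv (l2Z t lv').
  by apply/funext => x; rewrite /grad; ring.
have lq : l2 q by case: qW.
have lf := l2B lgu lq.
exists (fun e => grad s u e - q e); split; last first.
  (* Otherwise [grad s u] itself would lie in the closure, within [e] of the gradient of an l2
     function. *)
  move=> f0; have [_ /(_ e e0)[_ [[v lv <-] lgv]]] := qW.
  rewrite ltNge => /negP; apply; rewrite -lee_fin.
  have -> : q = grad s u.
    by apply/funext => x; apply/esym/eqP; rewrite -subr_eq0 (congr1 (@^~ x) f0).
  have := gap v lv; rewrite energyE gradB//; exact: l2B.
apply/reduced_l2_H1P; split=> //.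
  by apply/harmonicP => // v lv; apply: qorth; exists v.
(* Gradients have zero loop sums. For [q] this survives the closure, since a loop sum is an inner
   product with [l2_d2] of a delta. *)
apply/funext => e'; have ld := l2_l2_delta R e'.
rewrite -[LHS]l2_delta_inner -l2_d2_adjoint// innerBl//; last exact: l2_l2_d2.
rewrite l2_d2_adjoint// loop_sum_grad inner0l (inner_closure qW) ?subrr//.
  exact: l2_l2_d2.
move=> _ [v lv <-]; rewrite l2_d2_adjoint//; last exact: l2_grad.
by rewrite loop_sum_grad inner0l.
Qed.

End first_homology.

(** [xget] returns a value attained at some presentation, and [P] names it. Its generators are
    compared with other families only through coarse maps. *)
Lemma l2_betti1_gt0 (R : realType) (G : groupType) : finitely_presented G ->
  exists P : finite_presentation G, 0 < l2_betti1 R G <-> energy_gap R (@gen G P).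
Proof.
move=> [P0]; have [P _ bE] : range (@l2_betti1_pres R G) (l2_betti1 R G).
  by apply: xgetPex; exists (l2_betti1_pres R P0), P0.
by exists P; rewrite -bE energy_gapP l2_betti1_pres_gt0.
Qed.

(** * Coarse invariance of the energy gap *)

(** Bounded expansion for word metrics, with finite sets in place of radii, so that no generating
    family appears. [close_to_id] expresses bounded displacement in the same way. *)
Definition coarse_map (G H : groupType) (phi : G -> H) :=
  forall F : seq G, exists F' : seq H, forall x y : G,
    (x^-1 * y)%g \in F -> ((phi x)^-1 * phi y)%g \in F'.

Definition close_to_id (G : groupType) (chi : G -> G) :=
  exists F : seq G, forall x, (x^-1 * chi x)%g \in F.

Section coarse_invariance.
Variable R : realType.

Lemma sume_const (T : Type) (F : seq T) (c : \bar R) : (0 <= c)%E ->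
  (\sum_(k <- F) c = (size F)%:R%:E * c)%E.
Proof.
move=> c0; elim: F => [|k F IH]; first by rewrite mul0e big_nil.
by rewrite big_cons IH /= -addn1 natrD EFinD ge0_muleDl ?lee_fin// mul1e addeC.
Qed.

(** On the set where [x^-1 * psi (phi x)] is a fixed [k], the value [phi x] determines [x]. Hence
    the fibers of [phi] have at most [size F] points. *)
Lemma asum_fiber_le (G H : groupType) (phi : G -> H) (psi : H -> G)
    (F : seq G) (a : H -> R) :
  (forall x, 0 <= a x) -> (forall x, (x^-1 * psi (phi x))%g \in F) ->
  (asum (fun x => a (phi x)) <= (size F)%:R%:E * asum a)%E.
Proof.
move=> a0 HF.
pose A k := [set x | (x^-1 * psi (phi x))%g = k].
rewrite -(sume_const F) ?asum_ge0//.
apply: (@le_trans _ _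
  (\sum_(k <- F) asum (fun x => if x \in A k then a (phi x) else 0%R))%E).
  rewrite -asum_sum; last by move=> k x; case: ifP.
  apply: le_asum => x; rewrite (big_rem _ (HF x))/=.
  rewrite [X in _ <= X + _]ifT; last exact: mem_set.
  by rewrite lerDl sumr_ge0// => k _; case: ifP.
apply: lee_sum => k _; apply: asum_inj_le => // x y.
move=> /set_mem Ax /set_mem Ay xy.
by apply: (mulIg k); rewrite -{1}Ax -Ay xy !mulVKg.
Qed.

Section energy_bounds.
Variables (G : groupType) (n : nat) (s : 'I_n -> G).
Hypothesis gen_s : generates s.

Lemma energy_ge0 (u : G -> R) : (0 <= energy s u)%E.
Proof. by apply: asum_ge0 => x; rewrite sqr_ge0. Qed.

Lemma letter_diff_le l (u : G -> R) :
  (asum (fun x => ((u (x * letter_eval s l)%g - u x) ^+ 2)%R) <= energy s u)%E.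
Proof.
case: l => i b; apply: (@le_trans _ _ (asum (fun x => (grad s u (x, i) ^+ 2)%R))).
  rewrite /letter_eval; case: b => //=.
  rewrite -(reindex_asum _ (mulg_bijective (s i)^-1%g)).
  apply: le_asum => x /=; rewrite /grad/= mulgVK.
  by rewrite -[leRHS]sqrrN opprB.
rewrite /energy asum_prod; last by move=> x; rewrite sqr_ge0.
rewrite (bigD1 i)//= leeDl// sume_ge0// => j _.
by apply: asum_ge0 => x; rewrite sqr_ge0.
Qed.

Lemma translate_diff_le g : exists2 K : R, 0 <= K & forall u : G -> R,
  (asum (fun x => ((u (x * g)%g - u x) ^+ 2)%R) <= K%:E * energy s u)%E.
Proof.
have [w <-] := gen_s g; elim: w => [|l w [K K0 IH]].
  exists 0 => // u; rewrite mul0e word_eval_nil.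
  rewrite (_ : (fun x => _) = fun=> 0) ?asum0//.
  by apply/funext => x; rewrite mulg1 subrr expr0n.
(* The first letter is split off the word, and [sqrD_le] doubles both contributions. *)
exists (2 * K + 2); first by rewrite addr_ge0 ?mulr_ge0.
move=> u; rewrite EFinD ge0_muleDl ?lee_fin ?mulr_ge0// EFinM -muleA.
pose a x := (u (x * letter_eval s l * word_eval s w)%g - u (x * letter_eval s l)%g) ^+ 2.
pose b x := (u (x * letter_eval s l)%g - u x) ^+ 2.
have a0 x : 0 <= a x by rewrite sqr_ge0.
have b0 x : 0 <= b x by rewrite sqr_ge0.
apply: (@le_trans _ _ (asum (fun x => 2 * a x + 2 * b x))).
  apply: le_asum => x; rewrite /a /b word_eval_cons mulgA.
  by apply: le_trans (sqrD_le _ _); rewrite subrKA.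
rewrite asumD; last 2 first.
- by move=> x; rewrite mulr_ge0.
- by move=> x; rewrite mulr_ge0.
rewrite !asumZ// leeD// lee_pmul ?asum_ge0//; last exact: letter_diff_le.
apply: le_trans (IH u).
by rewrite -(reindex_asum (fun x => (u (x * word_eval s w)%g - u x) ^+ 2)
  (mulg_bijective (letter_eval s l))).
Qed.

Lemma translates_diff_le (F : seq G) : exists2 K : R, 0 <= K & forall u : G -> R,
  (asum (fun x => (\sum_(k <- F) (u (x * k)%g - u x) ^+ 2)%R) <= K%:E * energy s u)%E.
Proof.
elim: F => [|k F [K K0 IH]].
  exists 0 => // u; rewrite mul0e.
  by rewrite (_ : (fun x => _) = fun=> 0) ?asum0//; apply/funext => x; rewrite big_nil.
have [K' K'0 HK'] := translate_diff_le k.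
exists (K' + K); first exact: addr_ge0.
move=> u; under [X in asum X]funext do rewrite big_cons.
rewrite asumD; last 2 first.
- by move=> x; rewrite sqr_ge0.
- by move=> x; rewrite sumr_ge0// => j _; rewrite sqr_ge0.
by rewrite EFinD ge0_muleDl ?lee_fin// leeD.
Qed.

(** Each [u (chi x)] is one of the finitely many translates [u (x * k)] with [k] in [F], and the
    energy controls the difference between [u] and a translate. *)
Lemma l2_close_diff (chi : G -> G) (u : G -> R) : close_to_id chi ->
  (energy s u < +oo)%E -> l2 (fun x => u x - u (chi x)).
Proof.
move=> [F HF] uy; have [K K0 HK] := translates_diff_le F.
apply: (l2_le (g := fun x => \sum_(k <- F) (u (x * k)%g - u x) ^+ 2)) => [x|].
  rewrite (big_rem _ (HF x))/= mulVKg -sqrrN opprB lerDl sumr_ge0// => k _.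
  by rewrite sqr_ge0.
apply: (le_lt_trans (HK u)).
have : energy s u \is a fin_num by rewrite ge0_fin_numE ?energy_ge0.
by move=> /fineK <-; rewrite -EFinM ltry.
Qed.

End energy_bounds.

Lemma energy_comp_le (G H : groupType) (n m : nat) (s : 'I_n -> G) (t : 'I_m -> H)
    (phi : G -> H) (psi : H -> G) :
  generates t -> coarse_map phi -> close_to_id (psi \o phi) ->
  exists2 K : R, 0 <= K & forall u : H -> R,
    (energy s (fun x => u (phi x)) <= K%:E * energy t u)%E.
Proof.
move=> gen_t cphi [F HF]; have [F' HF'] := cphi [seq s i | i <- enum 'I_n].
have [K K0 HK] := translates_diff_le gen_t F'.
(* One factor for each source of loss: [n] edge directions, fibers of at most [size F] points, and
   [K] for the displacements in [F'] of the images of edges. *)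
exists (n%:R * ((size F)%:R * K)); first by rewrite !mulr_ge0.
move=> u; pose a y := \sum_(k <- F') (u (y * k)%g - u y) ^+ 2.
have a0 y : 0 <= a y by rewrite sumr_ge0// => k _; rewrite sqr_ge0.
rewrite [leLHS]asum_prod; last by move=> x; rewrite sqr_ge0.
rewrite EFinM -muleA.
rewrite -[X in (X%:R%:E * _)%E](size_enum_ord n) -sume_const; last first.
  by rewrite mule_ge0 ?energy_ge0// lee_fin mulr_ge0.
rewrite big_enum/=.
apply: lee_sum => i _; rewrite EFinM -muleA.
apply: (@le_trans _ _ (asum (fun x => a (phi x)))).
  apply: le_asum => x; rewrite /grad/=.
  have : ((phi x)^-1 * phi (x * s i))%g \in F'.
    by apply: HF'; rewrite mulKg map_f// mem_enum.
  move=> /(big_rem _) E; rewrite /a E/= mulVKg lerDl sumr_ge0// => k _.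
  by rewrite sqr_ge0.
apply: le_trans (asum_fiber_le a0 HF) _.
by rewrite lee_pmul ?asum_ge0// HK.
Qed.

Lemma l2_comp (G H : groupType) (phi : G -> H) (psi : H -> G) (v : H -> R) :
  close_to_id (psi \o phi) -> l2 v -> l2 (fun x => v (phi x)).
Proof.
move=> [F HF] lv.
have sq0 y : 0 <= v y ^+ 2 by rewrite sqr_ge0.
apply: (le_lt_trans (asum_fiber_le sq0 HF)).
have : asum (fun y => v y ^+ 2) \is a fin_num by rewrite ge0_fin_numE ?asum_ge0.
by move=> /fineK <-; rewrite -EFinM ltry.
Qed.

Lemma energy_gap_coarse (G H : groupType) (n m : nat) (s : 'I_n -> G) (t : 'I_m -> H)
    (phi : G -> H) (psi : H -> G) :
  generates s -> generates t -> coarse_map phi -> coarse_map psi ->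
  close_to_id (psi \o phi) -> close_to_id (phi \o psi) ->
  energy_gap R t -> energy_gap R s.
Proof.
move=> gen_s gen_t cphi cpsi psiphi phipsi [u [uy [e e0 gap]]].
have [K K0 HK] := energy_comp_le s gen_t cphi psiphi.
have [K' K'0 HK'] := energy_comp_le t gen_s cpsi phipsi.
exists (fun x => u (phi x)); split.
  apply: (le_lt_trans (HK u)).
  have : energy t u \is a fin_num by rewrite ge0_fin_numE ?energy_ge0.
  by move=> /fineK <-; rewrite -EFinM ltry.
exists (e / (K' + 1)); first by rewrite divr_gt0// ltr_wpDl.
move=> v lv; rewrite mulrC EFinM lee_pdivrMl ?ltr_wpDl//.
(* This l2 function is chosen so that subtracting it from [u] leaves the pullback of [u \o phi - v]
   along [psi], whose energy is at most [K'] times that of [u \o phi - v]. *)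
have lw : l2 (fun y => (u y - u (phi (psi y))) + v (psi y)).
  apply: l2D; first exact: (l2_close_diff gen_t phipsi uy).
  exact: (l2_comp phipsi lv).
apply: (le_trans (gap _ lw)).
rewrite (_ : (fun y => _) = fun y => u (phi (psi y)) - v (psi y)); last first.
  by apply/funext => y; ring.
apply: (le_trans (HK' (fun x => u (phi x) - v x))).
by rewrite lee_wpmul2r ?energy_ge0// lee_fin lerDl.
Qed.

End coarse_invariance.

(** * Box spaces *)

Section balls.
Variables (G : groupType) (n : nat) (s : 'I_n -> G).

Definition word_ball (r : nat) : seq G :=
  [seq word_eval s w | w : r.-bseq ('I_n * bool)].

Lemma word_ballP r g :
  reflect (exists2 w, (size w <= r)%N & word_eval s w = g) (g \in word_ball r).
Proof.
apply: (iffP idP) => [/mapP[w _ ->]|[w wr <-]].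
  by exists w => //; exact: size_bseq.
by apply/mapP; exists (Bseq wr) => //; rewrite mem_enum.
Qed.

Lemma word_ballM r r' g g' : g \in word_ball r -> g' \in word_ball r' ->
  (g * g')%g \in word_ball (r + r').
Proof.
move=> /word_ballP[w wr <-] /word_ballP[w' wr' <-]; apply/word_ballP.
by exists (w ++ w'); rewrite ?word_eval_cat// size_cat leq_add.
Qed.

Lemma word_ballV r g : g \in word_ball r -> g^-1%g \in word_ball r.
Proof.
move=> /word_ballP[w wr <-]; apply/word_ballP.
by exists (word_inv w); rewrite ?word_eval_inv// /word_inv size_rev size_map.
Qed.

Lemma word_ball_mono r r' : (r <= r')%N -> {subset word_ball r <= word_ball r'}.
Proof.
move=> rr' g /word_ballP[w wr <-]; apply/word_ballP.
by exists w => //; exact: leq_trans rr'.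
Qed.

Hypothesis gen_s : generates s.

Lemma word_ball_exhaust (F : seq G) : exists r, {subset F <= word_ball r}.
Proof.
elim: F => [|g F [r Fr]]; first by exists 0%N.
have [w wE] := gen_s g; exists (maxn r (size w)) => h; rewrite inE => /predU1P[->|hF].
  by apply/word_ballP; exists w => //; exact: leq_maxr.
by apply: word_ball_mono (Fr _ hF); exact: leq_maxl.
Qed.

End balls.

Section normal_subgroups.
Variables (G : groupType) (N : set G).
Hypothesis normN : normal_subgroup N.

Lemma normal1 : N 1%g.
Proof. by have [[/set_mem]] := normN. Qed.

Lemma normalF x y : N x -> N y -> N (x / y)%g.
Proof.
move=> Nx Ny; have [[_ Nd] _] := normN.
by apply/set_mem/Nd; exact: mem_set.
Qed.

Lemma normalV x : N x -> N x^-1%g.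
Proof. by move=> Nx; rewrite -div1g; exact: (normalF normal1). Qed.

Lemma normalM x y : N x -> N y -> N (x * y)%g.
Proof. by move=> Nx Ny; rewrite -[y]invgK; exact/normalF/normalV. Qed.

Lemma normalJ x g : N x -> N (x ^ g)%g.
Proof. by move=> Nx; exact: normN.2. Qed.

Lemma normal_conj g x : N x -> N (g * x * g^-1)%g.
Proof. by move=> Nx; have := normalJ g^-1%g Nx; rewrite conjgE invgK mulgA. Qed.

End normal_subgroups.

Lemma nat_valued_inf (R : realType) (A : set nat) : A !=set0 ->
  exists2 k, A k & inf [set (n%:R : R) | n in A] = k%:R /\ forall n, A n -> (k <= n)%N.
Proof.
move=> [a Aa]; have exA : exists n, `[< A n >] by exists a; exact/asboolP.
case: (ex_minnP exA) => k /asboolP Ak kmin; exists k => //.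
have kle n : A n -> (k <= n)%N by move=> An; apply: kmin; exact/asboolP.
split=> //; apply/eqP; rewrite eq_le; apply/andP; split.
  by apply: ge_inf; [exists 0 => _ [x _ <-]|exists k].
by apply: lb_le_inf; [exists k%:R, k|move=> _ [x Ax <-]; rewrite ler_nat kle].
Qed.

Lemma nat_valued_sup (R : realType) (A : set R) : finite_set A -> A !=set0 ->
  (forall x, A x -> exists k : nat, x = k%:R) ->
  has_sup A /\ exists2 k : nat, A k%:R & sup A = k%:R.
Proof.
move=> /finite_seqP[l lE] A0 Anat.
have Alb x : A x -> x <= \sum_(y <- l) `|y|.
  rewrite lE/= => xl; rewrite (big_rem _ xl)/=; apply: le_trans (ler_norm x) _.
  by rewrite lerDl sumr_ge0.
have supA : has_sup A by split=> //; exists (\sum_(y <- l) `|y|) => x; exact: Alb.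
split=> //; have exA : exists k : nat, `[< A k%:R >].
  have [x Ax] := A0; have [k xk] := Anat x Ax.
  by exists k; apply/asboolP; rewrite -xk.
have ubA k : `[< A k%:R >] -> (k <= Num.bound (\sum_(y <- l) `|y|))%N.
  move=> /asboolP /Alb kl; rewrite -(ler_nat R); apply: le_trans kl (ltW _).
  by rewrite archi_boundP// sumr_ge0.
case: (ex_maxnP exA ubA) => k /asboolP Ak kmax; exists k => //.
apply/eqP; rewrite eq_le (ub_le_sup supA.2 Ak) andbT.
apply: ge_sup A0 _ => x Ax; have [k' xk'] := Anat x Ax.
by rewrite xk' ler_nat; apply: kmax; apply/asboolP; rewrite -xk'.
Qed.

(** * Distances in a box space *)

Section box_metric.
Variables (R : realType) (G : groupType) (n : nat) (s : 'I_n -> G).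
Hypothesis gen_s : generates s.
Variable N : nat -> set G.
Hypothesis filtN : filtration N.
Local Notation d := (@box_dist R G n s N).
Local Notation diam := (@component_diam R G n s N).
Local Notation ball := (word_ball s).

Let normN i : normal_subgroup (N i). Proof. by case: filtN. Qed.

Definition box_pt i (g : G) : box_space N :=
  existT (fun i => lcosets (N i)) i
    (SigSub (mem_set (imageT (fun g : G => [set (g * x)%g | x in N i]) g))).

Lemma box_ptP (x : box_space N) : exists i g, x = box_pt i g.
Proof.
case: x => i [C CN]; have [g _ gC] := set_mem CN; exists i, g.
rewrite /box_pt; congr existT; exact/val_inj/esym.
Qed.

Lemma coset_mem i g h : [set (g * x)%g | x in N i] h <-> N i (g^-1 * h)%g.
Proof.
split=> [[x Nx <-]|Ngh]; first by rewrite mulKg.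
by exists (g^-1 * h)%g; rewrite ?mulVKg.
Qed.

Lemma box_pt_eq i g h : N i (g^-1 * h)%g -> box_pt i g = box_pt i h.
Proof.
move=> Ngh; rewrite /box_pt; congr existT; apply/val_inj => /=.
apply/seteqP; split=> x /coset_mem Nx; apply/coset_mem.
  have := normalM (normN i) (normalV (normN i) Ngh) Nx.
  by rewrite invgM invgK mulgA mulgK.
by have := normalM (normN i) Ngh Nx; rewrite mulgA mulgK.
Qed.

Lemma box_pt_inj i g h : box_pt i g = box_pt i h -> N i (g^-1 * h)%g.
Proof.
move=> gh; apply/coset_mem.
have -> : [set (g * x)%g | x in N i] = [set (h * x)%g | x in N i].
  exact: (congr1 (fun x : box_space N => \val (tagged x)) gh).
by apply/coset_mem; rewrite mulVg; exact: normal1.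
Qed.

(** An infimum of word lengths is attained, so distances are natural numbers and can be read off
    from the balls of [G] modulo [N i]. *)
Lemma cayley_distP i g h : exists k : nat,
  cayley_dist R s [set (g * x)%g | x in N i] [set (h * x)%g | x in N i] = k%:R /\
  forall r : nat, (k <= r)%N <-> exists2 b, b \in ball r & N i ((g * b)^-1 * h)%g.
Proof.
pose A : set nat := [set size w | w in [set w : word 'I_n |
  exists2 x, [set (g * x)%g | x in N i] x &
    [set (h * x)%g | x in N i] (x * word_eval s w)%g]].
have AE w : (exists2 x, [set (g * x)%g | x in N i] x &
    [set (h * x)%g | x in N i] (x * word_eval s w)%g) <->
    N i ((g * word_eval s w)^-1 * h)%g.
  (* A walk may start at any point [g * x] of the coset; by normality [x] can be conjugated past the
     word, which reduces to a start at [g]. *)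
  split=> [[_ [x Nx <-]] /coset_mem Nw|Nw].
    have /(normalV (normN i)) := Nw; rewrite !invgM invgK -!mulgA => Nw'.
    have := normalM (normN i) (normalJ (normN i) (word_eval s w) Nx) Nw'.
    by rewrite conjgE !mulgA mulgK mulgK.
  exists g; first by apply/coset_mem; rewrite mulVg; exact: normal1.
  by apply/coset_mem; have /(normalV (normN i)) := Nw; rewrite !invgM !invgK mulgA.
have A0 : A !=set0.
  have [w wE] := gen_s (g^-1 * h)%g; exists (size w), w => //; apply/AE.
  by rewrite wE mulVKg mulVg; exact: normal1.
have [k [w Ww wk] [kE kmin]] := @nat_valued_inf R A A0.
exists k; split=> [|r].
  by rewrite /cayley_dist -kE /A image_comp.
split=> [kr|[_ /word_ballP[w' wr <-] Nw]].
  exists (word_eval s w); last exact/AE.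
  by apply/word_ballP; exists w => //; rewrite wk.
by apply: leq_trans wr; apply: kmin; exists w' => //; exact/AE.
Qed.

(** By finite index only finitely many distances occur, so [sup] is a maximum and not a default
    value. *)
Lemma component_diamP i : [/\ exists k : nat, diam i = k%:R,
  forall g h, cayley_dist R s [set (g * x)%g | x in N i] [set (h * x)%g | x in N i]
     <= diam i & exists g h, diam i =
   cayley_dist R s [set (g * x)%g | x in N i] [set (h * x)%g | x in N i]].
Proof.
set D := [set cayley_dist R s CD.1 CD.2 | CD in lcosets (N i) `*` lcosets (N i)].
have finD : finite_set D.
  by apply: finite_image; apply: finite_setX; case: filtN => _ /(_ i).
have inD g h : D (cayley_dist R s [set (g * x)%g | x in N i] [set (h * x)%g | x in N i]).
  exists ([set (g * x)%g | x in N i], [set (h * x)%g | x in N i]) => //.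
  by split; [exists g|exists h].
have [||supD [k Dk kE]] := nat_valued_sup finD.
- by eexists; exact: (inD 1%g 1%g).
- move=> _ [[_ _] [/= [g _ <-] [h _ <-]] <-] /=.
  by have [k [kE _]] := cayley_distP i g h; exists k.
split; first by exists k.
  by move=> g h; apply: (ub_le_sup supD.2); exact: inD.
have [[_ _] [/= [g _ <-] [h _ <-]] gh] := Dk.
by exists g, h; rewrite gh -kE.
Qed.

Lemma box_dist_comp i g h : exists k : nat, d (box_pt i g) (box_pt i h) = k%:R /\
  forall r : nat, (k <= r)%N <-> exists2 b, b \in ball r & N i ((g * b)^-1 * h)%g.
Proof. by rewrite /box_dist eqxx; exact: cayley_distP. Qed.

Lemma box_dist_le i g h r : d (box_pt i g) (box_pt i h) <= r%:R <->
  exists2 b, b \in ball r & N i ((g * b)^-1 * h)%g.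
Proof. by have [k [-> <-]] := box_dist_comp i g h; rewrite ler_nat. Qed.

Lemma box_dist_neq i j g h : i != j ->
  d (box_pt i g) (box_pt j h) = diam i + diam j.
Proof. by move=> /negbTE ij; rewrite /box_dist ij. Qed.

Lemma diam_ge0 i : 0 <= diam i.
Proof. by have [[k ->] _ _] := component_diamP i. Qed.

Lemma box_dist_diam i g h : d (box_pt i g) (box_pt i h) <= diam i.
Proof. by rewrite /box_dist eqxx; have [_ + _] := component_diamP i; exact. Qed.

Lemma box_dist_nat x y : exists k : nat, d x y = k%:R.
Proof.
have [i [g ->]] := box_ptP x; have [j [h ->]] := box_ptP y.
have [<-|ij] := eqVneq i j; first by have [k [-> _]] := box_dist_comp i g h; exists k.
have [[k kE] _ _] := component_diamP i; have [[k' kE'] _ _] := component_diamP j.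
by rewrite box_dist_neq// kE kE'; exists (k + k')%N; rewrite natrD.
Qed.

Lemma box_dist_ge0 x y : 0 <= d x y.
Proof. by have [k ->] := box_dist_nat x y. Qed.

Lemma box_dist_sym_le x y (r : nat) : d x y <= r%:R -> d y x <= r%:R.
Proof.
have [i [g ->]] := box_ptP x; have [j [h ->]] := box_ptP y.
have [<-|ij] := eqVneq i j; last by rewrite !box_dist_neq// 1?eq_sym// addrC.
move=> /box_dist_le[b br Nb]; apply/box_dist_le; exists b^-1%g; first exact: word_ballV.
have := normal_conj (normN i) b (normalV (normN i) Nb).
by rewrite !invgM !invgK !mulgA mulgK.
Qed.

Lemma box_dist_triangle x y z (r r' : nat) :
  d x y <= r%:R -> d y z <= r'%:R -> d x z <= (r + r')%N%:R.
Proof.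
have [i [g ->]] := box_ptP x; have [j [h ->]] := box_ptP y.
have [k [l ->]] := box_ptP z.
have [<-|ij] := eqVneq i j; have [<-|ik] := eqVneq i k.
- move=> /box_dist_le[b br Nb] /box_dist_le[b' b'r Nb']; apply/box_dist_le.
  exists (b * b')%g; first exact: word_ballM.
  have := normalM (normN i) (normalJ (normN i) b' Nb) Nb'.
  by rewrite conjgE !invgM !mulgA mulgK mulgK.
- by rewrite !(box_dist_neq _ _ ik) natrD => rr rr'; apply: ler_wpDl.
(* Reaching another component already costs [diam i], which bounds every distance inside component
   [i]. *)
- rewrite (box_dist_neq _ _ ij) => ijr _.
  apply: le_trans (box_dist_diam i g l) _; apply: le_trans (_ : _ <= r%:R) _.
    by apply: le_trans ijr; rewrite lerDl diam_ge0.
  by rewrite ler_nat leq_addr.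
rewrite box_dist_neq// [d (box_pt i g) _]box_dist_neq// => ijr.
have [<-|jk] := eqVneq j k.
  by move=> _; apply: le_trans ijr _; rewrite ler_nat leq_addr.
rewrite box_dist_neq// natrD => jkr'; apply: lerD.
  by apply: le_trans ijr; rewrite lerDl diam_ge0.
by apply: le_trans jkr'; rewrite lerDr diam_ge0.
Qed.

End box_metric.

(** * Limits of coarse equivalences *)

(** Turns an element of a finite ball that depends on [i] into a single one along [U]; the values of
    the limit maps arise in this way. *)
Lemma ultra_pigeonhole (U : set_system nat) (T : eqType) (F : seq T)
    (Q : T -> nat -> Prop) : UltraFilter U ->
  U [set i | exists2 b, b \in F & Q b i] -> exists2 b, b \in F & U (Q b).
Proof.
move=> ultraU; elim: F => [U0|b F IH UF].
  by case: (filter_ex U0) => i [].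
have [Ub|Ub] := in_ultra_setVsetC (Q b) ultraU.
  by exists b => //; exact: mem_head.
have [|b' b'F Ub'] := IH.
  apply: filterS (filterI UF Ub) => i [[b' + Qb'] nQb].
  by rewrite inE => /predU1P[b'b|b'F]; [rewrite b'b in Qb'|exists b'].
by exists b' => //; rewrite inE b'F orbT.
Qed.

Definition infinite_group (G : groupType) :=
  forall F : seq G, exists g, g \notin F.

Section bornologous.
Variable R : realType.

Definition bornologous (X Y : Type) (dX : X -> X -> R) (dY : Y -> Y -> R)
    (f : X -> Y) :=
  forall r : nat, exists K : nat, forall a b,
    dX a b <= r%:R -> dY (f a) (f b) <= K%:R.

(* A sequence of maps [p i : G -> X] that looks, along the ultrafilter [U] and on
   each finite piece of [G], like an isometric embedding whose image contains
   the balls centered in it. *)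
Record limit_frame (U : set_system nat) (G : groupType) (X : Type)
    (d : X -> X -> R) (p : nat -> G -> X) : Prop := LimitFrame {
  frame_lip : forall F : seq G, exists r : nat, forall i g b,
    b \in F -> d (p i g) (p i (g * b)%g) <= r%:R;
  frame_cover : forall r : nat, exists F : seq G, forall x g,
    U [set i | d (p i g) (x i) <= r%:R] ->
    exists2 b, b \in F & U [set i | x i = p i (g * b)%g];
  frame_inj : forall g h, U [set i | p i g = p i h] -> g = h }.

(** If [x^-1 * y] is in [F], the points [f (p i x)] and [f (p i y)] are uniformly close. The
    covering property then expresses the second as [q i (phi x * b)] with [b] in a finite set, and
    injectivity of the frame identifies [phi y]. *)
Lemma limit_coarse_map (U : set_system nat) (G H : groupType) (X Y : Type)
    (dX : X -> X -> R) (dY : Y -> Y -> R) p q (f : X -> Y) (phi : G -> H) :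
  UltraFilter U -> limit_frame U dX p -> limit_frame U dY q ->
  bornologous dX dY f -> (forall g, U [set i | f (p i g) = q i (phi g)]) ->
  coarse_map phi.
Proof.
move=> ultraU pF qF bf phiE F.
have [r Hr] := frame_lip pF F; have [K HK] := bf r.
have [F' HF'] := frame_cover qF K; exists F' => x y xyF.
have [|b bF' Ub] := HF' (fun i => f (p i y)) (phi x).
  apply: filterS (phiE x) => i /= <-; apply: HK.
  by have := Hr i x _ xyF; rewrite mulVKg.
suff -> : phi y = (phi x * b)%g by rewrite mulKg.
by apply: (frame_inj qF); apply: filterS (filterI Ub (phiE y)) => i [/= <- ->].
Qed.

Lemma limit_close_to_id (U : set_system nat) (G H : groupType) (X Y : Type)
    (dX : X -> X -> R) p (q : nat -> H -> Y) (f : X -> Y) (f' : Y -> X)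
    (phi : G -> H) (psi : H -> G) (C : nat) :
  UltraFilter U -> limit_frame U dX p ->
  (forall x, dX x (f' (f x)) <= C%:R) ->
  (forall g, U [set i | f (p i g) = q i (phi g)]) ->
  (forall h, U [set i | f' (q i h) = p i (psi h)]) ->
  close_to_id (psi \o phi).
Proof.
move=> ultraU pF HC phiE psiE; have [F HF] := frame_cover pF C.
exists F => g /=.
have [|b bF Ub] := HF (fun i => f' (f (p i g))) g.
  by apply: filterS filterT => i _; exact: HC.
suff -> : psi (phi g) = (g * b)%g by rewrite mulKg.
apply: (frame_inj pF).
apply: filterS (filterI (filterI Ub (phiE g)) (psiE (phi g))) => i [[/= <- ->] <-].
by [].
Qed.

(** * Components of a box space as approximations of the group *)

Section box_frame.
Variables (G : groupType) (n : nat) (s : 'I_n -> G).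
Hypothesis gen_s : generates s.
Variable N : nat -> set G.
Hypothesis filtN : filtration N.
Local Notation d := (@box_dist R G n s N).
Local Notation diam := (@component_diam R G n s N).
Local Notation ball := (word_ball s).

Lemma filtration_antitone i j : (i <= j)%N -> N j `<=` N i.
Proof.
have [_ _ NS _] := filtN; move=> /subnK <-.
by elim: (j - i)%N => // k IH; exact: subset_trans (NS _) IH.
Qed.

Lemma filtration_separated (U : set_system nat) (k : nat -> nat) g :
  ProperFilter U -> (forall a, U [set i | (a <= k i)%N]) ->
  U [set i | N (k i) g] -> g = 1%g.
Proof.
move=> pU ku UN; have [_ _ _ Ncap] := filtN.
have : (\bigcap_i N i) g.
  move=> a _; have [i [/= ai Ni]] := filter_ex (filterI (ku a) UN).
  exact: filtration_antitone ai _ Ni.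
by rewrite Ncap.
Qed.

(** If components of diameter at most [r] recurred forever, each [g] would be congruent to an
    element of [ball r] modulo every [N i]. The pigeonhole fixes this element, the trivial
    intersection makes it equal to [g], and [G] would be finite. *)
Lemma diam_unbounded (r : nat) : infinite_group G ->
  exists i0, forall i, (i0 <= i)%N -> r%:R < diam i.
Proof.
move=> infG; apply: contrapT => no.
have small i : exists2 j, (i <= j)%N & diam j <= r%:R.
  apply: contrapT => noi; apply: no; exists i => j ij; rewrite ltNge.
  by apply/negP => jr; apply: noi; exists j.
have [g] := infG (ball r); apply/negP; rewrite negbK.
have [U [ultraU sU]] := @ultraFilterLemma nat \oo _.
have [|b br Ub] :=
  @ultra_pigeonhole U _ (ball r) (fun b i => N i (b^-1 * g)%g) ultraU.
  apply: filterS filterT => i _; have [j ij jr] := small i.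
  have := le_trans (box_dist_diam R gen_s filtN j 1%g g) jr.
  move=> /(box_dist_le R gen_s filtN)[b br]; rewrite mul1g => Nb.
  by exists b => //; exact: filtration_antitone ij _ Nb.
suff bg : (b^-1 * g = 1)%g by rewrite -(mulVKg b g) bg mulg1.
apply: (@filtration_separated U id) => // a.
by apply: sU; exists a.
Qed.

(** Covering holds because a point within [r] of [p i g] is in the same component once the diameter
    exceeds [r]; injectivity is the trivial intersection of the filtration. The centres [t i] leave
    room for the uncontrolled images of base points. *)
Lemma box_limit_frame (U : set_system nat) (k : nat -> nat) (t : nat -> G) :
  infinite_group G -> UltraFilter U -> (forall a, U [set i | (a <= k i)%N]) ->
  limit_frame U d (fun i g => box_pt N (k i) (t i * g)%g).
Proof.
move=> infG ultraU ku; split.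
- move=> F; have [r Fr] := word_ball_exhaust gen_s F; exists r => i g b /Fr br.
  apply/(box_dist_le R gen_s filtN); exists b => //.
  by rewrite -[(_ * g * b)%g]mulgA mulVg; case: filtN => /(_ (k i)) /normal1.
- move=> r; exists (ball r) => x g Ux.
  have [i0 Hi0] := diam_unbounded r infG.
  apply: ultra_pigeonhole; apply: filterS (filterI Ux (ku i0)) => i [/= + /Hi0].
  have [j [h ->]] := box_ptP (x i).
  have [<-|kj] := eqVneq (k i) j; last first.
    rewrite (box_dist_neq _ _ _ _ _ kj) => kjr lr; exfalso.
    have : r%:R < diam (k i) + diam j.
      by apply: lt_le_trans lr _; rewrite lerDl diam_ge0.
    by rewrite ltNge kjr.
  move=> /(box_dist_le R gen_s filtN)[b br Nb] _; exists b => //.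
  by apply/esym/(box_pt_eq filtN); rewrite mulgA.
move=> g h Ugh; apply: (mulgI g^-1%g); rewrite mulVg; apply/esym.
apply: (filtration_separated _ ku); apply: filterS Ugh => i /= /(box_pt_inj filtN).
by rewrite invgM -mulgA mulKg; apply.
Qed.


Lemma box_unbounded (D : nat) : infinite_group G -> exists x y, D%:R < d x y.
Proof.
move=> /(diam_unbounded D)[i0 Hi0].
exists (box_pt N i0 1%g), (box_pt N i0.+1 1%g).
rewrite box_dist_neq; last by rewrite neq_ltn ltnSn.
by apply: lt_le_trans (Hi0 _ (leqnn _)) _; rewrite lerDl (diam_ge0 R gen_s).
Qed.

Lemma box_bounded (F : seq G) : (forall g, g \in F) ->
  exists D : nat, forall x y, d x y <= D%:R.
Proof.
move=> GF; have [r Fr] := word_ball_exhaust gen_s F.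
have comp_le i g h : d (box_pt N i g) (box_pt N i h) <= r%:R.
  apply/(box_dist_le R gen_s filtN); exists (g^-1 * h)%g; first exact/Fr/GF.
  by rewrite mulVKg mulVg; case: filtN => /(_ i) /normal1.
have diam_le i : diam i <= r%:R.
  have [_ _ [g [h ->]]] := component_diamP R gen_s filtN i.
  by have := comp_le i g h; rewrite /box_dist eqxx.
exists (r + r)%N => x y; have [i [g ->]] := box_ptP x; have [j [h ->]] := box_ptP y.
have [<-|ij] := eqVneq i j.
  by apply: le_trans (comp_le _ _ _) _; rewrite ler_nat leq_addr.
by rewrite (box_dist_neq _ _ _ _ _ ij) natrD lerD.
Qed.

End box_frame.

(** Coarse equivalence in a form symmetric in the two spaces, so that a lemma about [f] also applies
    to [f']. *)
Record coarse_inverse (X Y : Type) (dX : X -> X -> R) (dY : Y -> Y -> R)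
    (f : X -> Y) (f' : Y -> X) (C : nat) : Prop := CoarseInverse {
  coarse_inverse_born : bornologous dX dY f;
  coarse_inverse_born' : bornologous dY dX f';
  coarse_inverse_close : forall x, dX x (f' (f x)) <= C%:R;
  coarse_inverse_close' : forall y, dY y (f (f' y)) <= C%:R }.

Lemma coarse_inverse_sym (X Y : Type) (dX : X -> X -> R) (dY : Y -> Y -> R)
    (f : X -> Y) (f' : Y -> X) (C : nat) :
  coarse_inverse dX dY f f' C -> coarse_inverse dY dX f' f C.
Proof. by case. Qed.

(** * From a coarse equivalence of box spaces to maps of groups *)

Section two_box_spaces.
Variables (G H : groupType) (m n : nat) (s : 'I_m -> G) (t : 'I_n -> H).
Hypotheses (gen_s : generates s) (gen_t : generates t).
Variables (N : nat -> set G) (M : nat -> set H).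
Hypotheses (filtN : filtration N) (filtM : filtration M).
Local Notation dG := (@box_dist R G m s N).
Local Notation dH := (@box_dist R H n t M).

Lemma nat_bound (x : R) : exists k : nat, x <= k%:R.
Proof.
exists (Num.bound `|x|); apply: le_trans (ler_norm x) _.
exact/ltW/archi_boundP.
Qed.

Lemma coarsely_equivalent_inverse : coarsely_equivalent dG dH ->
  exists f f' C, coarse_inverse dG dH f f' C.
Proof.
move=> [f [[rho_m [rho_p [[m0 mproper] [p0 _] Hf]]] [C0 _ HC0]]].
have [C HC] := nat_bound C0.
have /choice[f' Hf'] y : exists x, dH y (f x) <= C%:R.
  by have [x xC] := HC0 y; exists x; exact: le_trans HC.
(* Properness of [rho_m]: its preimage of the interval from [0] to [r] is bounded. *)
have lower (r : nat) : exists K : nat, forall a b,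
    dH (f a) (f b) <= r%:R -> dG a b <= K%:R.
  have [|K0 [_ HK0]] := mproper [set x | 0 <= x <= r%:R].
    exists r%:R; split=> // x rx y /= /andP[y0 yr].
    by rewrite ger0_norm// (le_trans yr)// ltW.
  have [K HK] := nat_bound (K0 + 1); exists K => a b abr.
  apply: le_trans (ler_norm _) (le_trans _ HK); apply: HK0; first by rewrite ltrDl.
  have ab0 := box_dist_ge0 R gen_s filtN a b.
  split=> //=; rewrite m0//=; apply: le_trans abr.
  by have /andP[] := Hf a b.
have upper : bornologous dG dH f.
  (* [rho_p] need not be monotone. Distances are natural numbers, so the sum of its values at
     [0, ..., r] dominates each value that matters. *)
  move=> r; have [K HK] := nat_bound (\sum_(k < r.+1) rho_p k%:R).
  exists K => a b; have [k kE] := box_dist_nat R gen_s filtN a b.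
  have /andP[_] := Hf a b; rewrite kE ler_nat => fab kr.
  apply: le_trans fab (le_trans _ HK).
  have kr1 : (k < r.+1)%N by [].
  by rewrite (bigD1 (Ordinal kr1))//= lerDl sumr_ge0// => i _; exact: p0.
have [K HK] := lower C; exists f, f', (C + K)%N; split=> //.
- move=> r; have [L HL] := lower (C + r + C)%N; exists L => y y' yy'; apply: HL.
  apply: (box_dist_triangle gen_t filtM) (Hf' y').
  apply: (box_dist_triangle gen_t filtM) yy'.
  exact: (box_dist_sym_le gen_t filtM).
- move=> x; apply: le_trans (HK _ _ (Hf' (f x))) _.
  by rewrite ler_nat leq_addl.
by move=> y; apply: le_trans (Hf' y) _; rewrite ler_nat leq_addr.
Qed.

Variables (f : box_space N -> box_space M) (f' : box_space M -> box_space N).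
Variable C : nat.
Hypothesis ff' : coarse_inverse dG dH f f' C.

(** A group is infinite exactly when its box space is unbounded, and boundedness passes through a
    coarse inverse. *)
Lemma infinite_group_coarse : infinite_group H -> infinite_group G.
Proof.
move=> infH; apply: contrapT => /existsNP[F finG].
have GF g : g \in F by apply: contrapT => gF; apply: finG; exists g; exact/negP.
have [D HD] := box_bounded gen_s filtN GF.
have [K HK] := coarse_inverse_born ff' D.
have [y [y']] := box_unbounded gen_t filtM (C + K + C) infH.
rewrite ltNge => /negP; apply.
apply: (box_dist_triangle gen_t filtM); last first.
  apply: (box_dist_sym_le gen_t filtM); exact: (coarse_inverse_close' ff' y').
apply: (box_dist_triangle gen_t filtM (coarse_inverse_close' ff' y)).
exact/HK/HD.
Qed.

(** Otherwise a single component [j] would receive base points from arbitrarily late components.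
    Their images are within [diam j] of each other, so [f'] would bring the base points within a
    fixed distance, while the diameters of their components grow. *)
Lemma component_index_unbounded (U : set_system nat) (k : nat -> nat) (h : nat -> H) :
  infinite_group G -> UltraFilter U -> \oo `<=` U ->
  (forall i, f (box_pt N i 1%g) = box_pt M (k i) (h i)) ->
  forall a, U [set i | (a <= k i)%N].
Proof.
move=> infG ultraU sU fE a.
have [//|Uk] := in_ultra_setVsetC [set i | (a <= k i)%N] ultraU.
have [|j _ Uj] := @ultra_pigeonhole U _ (iota 0 a) (fun j i => k i = j) ultraU.
  apply: filterS Uk => i /= /negP; rewrite -ltnNge => ka.
  by exists (k i); rewrite // mem_iota.
have [i1 /= ki1] := filter_ex Uj.
have [[D DE] _ _] := component_diamP R gen_t filtM j.
have [K HK] := coarse_inverse_born' ff' D.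
have [i0 Hi0] := diam_unbounded gen_s filtN (C + K + C) infG.
(* The index [i] must both make the diameter large and differ from [i1]. *)
have Ularge : U [set i | (maxn i0 i1.+1 <= i)%N] by apply: sU; exists (maxn i0 i1.+1).
have [i [/= ki]] := filter_ex (filterI Uj Ularge).
rewrite geq_max => /andP[/Hi0 i0i i1i]; exfalso.
have : dG (box_pt N i1 1%g) (box_pt N i 1%g) <= (C + K + C)%N%:R.
  apply: (box_dist_triangle gen_s filtN); last first.
    apply: (box_dist_sym_le gen_s filtN); exact: (coarse_inverse_close ff').
  apply: (box_dist_triangle gen_s filtN (coarse_inverse_close ff' _)).
  by apply: HK; rewrite !fE ki1 ki -DE box_dist_diam.
rewrite box_dist_neq; last by rewrite neq_ltn i1i.
apply/negP; rewrite -ltNge; apply: lt_le_trans i0i _.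
by rewrite lerDr (diam_ge0 R gen_s).
Qed.

Lemma infinite_box_coarse_maps : infinite_group G -> infinite_group H ->
  exists (phi : G -> H) (psi : H -> G), [/\ coarse_map phi, coarse_map psi,
    close_to_id (psi \o phi) & close_to_id (phi \o psi)].
Proof.
move=> infG infH.
have [U [ultraU sU]] := @ultraFilterLemma nat \oo _.
pose p i g := box_pt N i (1 * g)%g.
have pF : limit_frame U dG p.
  apply: (@box_limit_frame G m s gen_s N filtN U id (fun=> 1%g)) => // a.
  by apply: sU; exists a.
have /choice[kh khE] i : exists kh : nat * H, f (box_pt N i 1%g) = box_pt M kh.1 kh.2.
  by have [k [h E]] := box_ptP (f (box_pt N i 1%g)); exists (k, h).
(* The target frame is centred at the image of the base point, so [f] maps centre to centre
   exactly. *)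
pose q i h := box_pt M (kh i).1 ((kh i).2 * h)%g.
have qF : limit_frame U dH q.
  apply: (box_limit_frame gen_t filtM) => //.
  exact: (component_index_unbounded infG ultraU sU khE).
have q1 i : f (p i 1%g) = q i 1%g by rewrite /p /q mul1g mulg1 khE.
have /choice[phi phiE] g : exists h, U [set i | f (p i g) = q i h].
  have [r Hr] := frame_lip pF [:: g]; have [K HK] := coarse_inverse_born ff' r.
  have [F HF] := frame_cover qF K.
  have [|b _ Ub] := HF (fun i => f (p i g)) 1%g; last by exists (1 * b)%g.
  apply: filterS filterT => i _ /=; rewrite -q1; apply: HK.
  by have := Hr i 1%g g (mem_head _ _); rewrite mul1g.
have /choice[psi psiE] h : exists g, U [set i | f' (q i h) = p i g].
  have [r Hr] := frame_lip qF [:: h]; have [K HK] := coarse_inverse_born' ff' r.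
  (* [f'] returns the centre only up to [C], which is added to the expansion bound [K]. *)
  have [F HF] := frame_cover pF (C + K)%N.
  have [|b _ Ub] := HF (fun i => f' (q i h)) 1%g; last by exists (1 * b)%g.
  apply: filterS filterT => i _ /=.
  apply: (box_dist_triangle gen_s filtN (coarse_inverse_close ff' _)).
  rewrite q1; apply: HK.
  by have := Hr i 1%g h (mem_head _ _); rewrite mul1g.
exists phi, psi; split.
- exact: (limit_coarse_map ultraU pF qF (coarse_inverse_born ff') phiE).
- exact: (limit_coarse_map ultraU qF pF (coarse_inverse_born' ff') psiE).
- exact: (limit_close_to_id ultraU pF (coarse_inverse_close ff') phiE psiE).
- exact: (limit_close_to_id ultraU qF (coarse_inverse_close' ff') psiE phiE).
Qed.

End two_box_spaces.
End bornologous.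

Lemma const1_coarse_map (G H : groupType) : coarse_map (fun _ : G => 1%g : H).
Proof. by move=> F; exists [:: 1%g] => x y _; rewrite mulVg mem_head. Qed.

Lemma finite_close_to_id (G : groupType) (chi : G -> G) :
  ~ infinite_group G -> close_to_id chi.
Proof.
move=> /existsNP[F finG]; exists F => x.
by apply: contrapT => xF; apply: finG; exists (x^-1 * chi x)%g; exact/negP.
Qed.

Lemma box_coarse_maps (R : realType) (G H : groupType) (m n : nat)
    (s : 'I_m -> G) (t : 'I_n -> H) (N : nat -> set G) (M : nat -> set H) :
  generates s -> generates t -> filtration N -> filtration M ->
  coarsely_equivalent (@box_dist R G m s N) (@box_dist R H n t M) ->
  exists (phi : G -> H) (psi : H -> G), [/\ coarse_map phi, coarse_map psi,
    close_to_id (psi \o phi) & close_to_id (phi \o psi)].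
Proof.
move=> gen_s gen_t filtN filtM.
move=> /(coarsely_equivalent_inverse gen_s gen_t filtN filtM)[f [f' [C ff']]].
have infHG := infinite_group_coarse gen_s gen_t filtN filtM ff'.
have infGH := infinite_group_coarse gen_t gen_s filtM filtN (coarse_inverse_sym ff').
have [infG|finG] := pselect (infinite_group G).
  exact: (infinite_box_coarse_maps gen_s gen_t filtN filtM ff' infG (infGH infG)).
have finH : ~ infinite_group H by move=> /infHG.
(* In finite groups all displacements lie in one finite set, so constant maps are coarse
   inverses. *)
exists (fun=> 1%g), (fun=> 1%g); split; try exact: const1_coarse_map.
  exact: finite_close_to_id.
exact: finite_close_to_id.
Qed.

Theorem theorem1p9 (R : realType) (G H : groupType)
    (fpG : finitely_presented G) (fpH : finitely_presented H)
    (rfG : residually_finite G) (rfH : residually_finite H)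
    (N : nat -> set G) (M : nat -> set H)
    (filtN : filtration N) (filtM : filtration M)
    (m n : nat) (S : 'I_m -> G) (T : 'I_n -> H)
    (genS : generates S) (genT : generates T) :
  coarsely_equivalent (@box_dist R G m S N) (@box_dist R H n T M) ->
  (0 < l2_betti1 R G <-> 0 < l2_betti1 R H).
Proof.
move=> /(box_coarse_maps genS genT filtN filtM)[phi [psi [cphi cpsi psiphi phipsi]]].
have [P ->] := l2_betti1_gt0 R fpG; have [Q ->] := l2_betti1_gt0 R fpH.
have genP := gen_generates P; have genQ := gen_generates Q.
split.
  (* The gap is pulled back, so it travels against the map: [psi], from [H] to [G], carries it from
     [G] to [H]. *)
  exact: (energy_gap_coarse genQ genP cpsi cphi phipsi psiphi).
exact: (energy_gap_coarse genP genQ cphi cpsi psiphi phipsi).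
Qed.
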